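(* Let $s\in(1/2,1)$, $0<k<2s$ with $k<1$, $\varepsilon\in(0,1]$, and let $(J^s)$ satisfy Hypothesis (H1) below. Let $C_L,\lambda_L>0$ be constants, depending only on $k$, $d$ and the family $J$ (not on $\varepsilon$ or $s$), such that $L^*_\varepsilon(\langle x\rangle^k)\le C_L-\lambda_L\langle x\rangle^k$, where $L^*_\varepsilon\varphi(x)=\varepsilon^{-2s}\int J^s_\varepsilon(y)[\varphi(x+y)-\varphi(x)]\,dy-x\cdot\nabla\varphi(x)$. Then the semigroup $(S_t)_{t\ge0}$ associated with $$\partial_tu=\frac{1}{\varepsilon^{2s}}(J^s_\varepsilon*u-u)+\mathrm{div}(xu)$$ satisfies, with $V(x)=\langle x\rangle^k$, for all $u_0\in L^1_k$ and $t\ge0$, $$\|S_tu_0\|_{V}\le e^{-\lambda_L t}\|u_0\|_V+\frac{C_L}{\lambda_L}(1-e^{-\lambda_L t})\|u_0\|_{L^1},$$ where $\|f\|_V=\int V|f|\,dx$.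
   Context: $\langle x\rangle=(1+|x|^2)^{1/2}$; $L^1_k$ the space of $f$ with $\int\langle x\rangle^k|f|<\infty$; $J^s_\varepsilon(x)=\varepsilon^{-d}J^s(x/\varepsilon)$; $\hat f(\xi)=\int e^{-ix\cdot\xi}f$. The semigroup $S_t$ maps $u_0$ to the mild solution $u(t)$ of the equation (Duhamel formula with $T_tf(x)=e^{(d-\varepsilon^{-2s})t}f(e^tx)$). Hypothesis (H1): $(J^s)_{s\in(1/2,1)}$ is a family of probability densities on $\mathbb{R}^d$ with $J^s\in L^1\cap L^p$ for some $p\in(1,\infty]$, such that (i) $\int\min\{1,|y|^2\}J^s<\infty$; (ii) there exist $\delta,C_0>0$ independent of $s$ with $\hat J^s(\xi)=1-|\xi|^{2s}+R_s(\xi)$, $|R_s(\xi)|\le C_0|\xi|^{2s+\delta}$ for $|\xi|\le1$; (iii) there exist $C,R>0$, $\Psi\in L^1_2$ with $\int x\Psi=0$, independent of $s$, with $J^s(x)\le C(1-s)|x|^{-d-2s}+\Psi(x)$ for $|x|\ge R$. *)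

(* Defs.v *)
From HB Require Import structures.
From mathcomp Require Import all_boot all_order all_algebra.
From mathcomp Require Import all_classical all_reals all_analysis.
From mathcomp Require Import complex.
Set Implicit Arguments. Unset Strict Implicit. Unset Printing Implicit Defensive.
Import Order.TTheory GRing.Theory Num.Theory numFieldNormedType.Exports.
Local Open Scope classical_set_scope.
Local Open Scope ring_scope.

Section Defs.
Variable R : realType.

Definition dotp (d : nat) (x y : 'rV[R]_d) : R := \sum_(i < d) x ord0 i * y ord0 i.
Definition enorm (d : nat) (x : 'rV[R]_d) : R := Num.sqrt (dotp x x).
Definition jbr (d : nat) (x : 'rV[R]_d) : R := Num.sqrt (1 + enorm x ^+ 2).
Definition Vk (d : nat) (k : R) (x : 'rV[R]_d) : R := jbr x `^ k.

Definition borel_Rd (d : nat) : set (set 'rV[R]_d) :=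
  <<s [set A : set 'rV[R]_d | open A] >>.
Definition meas_Rd (d : nat) (f : 'rV[R]_d -> R) : Prop :=
  forall B : set R, measurable B -> borel_Rd (f @^-1` B).
Definition meas_tRd (d : nat) (u : R -> 'rV[R]_d -> R) : Prop :=
  forall B : set R, measurable B ->
    <<s [set A : set (R * 'rV[R]_d) | open A] >>
      ((fun p : R * 'rV[R]_d => u p.1 p.2) @^-1` B).

(* Integral of a nonnegative function on R^d, computed as the iterated
   one-dimensional Lebesgue integral (equal to the d-dimensional Lebesgue
   integral for Borel functions, by Tonelli). *)
Fixpoint iint (n : nat) : ('rV[R]_n -> \bar R) -> \bar R :=
  match n return ('rV[R]_n -> \bar R) -> \bar R with
  | 0 => fun f => f 0
  | n'.+1 => fun f =>
      (\int[lebesgue_measure]_t iint (fun x : 'rV[R]_n' =>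
                                   f (row_mx (t%:M : 'rV[R]_1) x)))%E
  end.
Definition Iint (d : nat) (f : 'rV[R]_d -> R) : \bar R :=
  (iint (fun x => (Num.max (f x) 0)%:E) - iint (fun x => (Num.max (- f x) 0)%:E))%E.

Definition ae_Rd (d : nat) (P : 'rV[R]_d -> Prop) : Prop :=
  exists N : set 'rV[R]_d, borel_Rd N /\
    iint (fun x => (\1_N x : R)%:E) = 0%E /\ forall x, ~ N x -> P x.

Definition L1norm (d : nat) (f : 'rV[R]_d -> R) : \bar R :=
  iint (fun x => `|f x|%:E).
Definition normV (d : nat) (k : R) (f : 'rV[R]_d -> R) : \bar R :=
  iint (fun x => (Vk k x * `|f x|)%:E).
Definition L1k (d : nat) (k : R) (f : 'rV[R]_d -> R) : Prop :=
  meas_Rd f /\ (normV k f < +oo)%E.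

Definition fourier (d : nat) (f : 'rV[R]_d -> R) (xi : 'rV[R]_d) : R[i] :=
  ((fine (Iint (fun x => cos (dotp x xi) * f x)))
    +i* (- fine (Iint (fun x => sin (dotp x xi) * f x))))%C.

Definition H1 (d : nat) (J : R -> 'rV[R]_d -> R) : Prop :=
  (forall s, 2^-1 < s < 1 ->
     meas_Rd (J s) /\ (forall x, 0 <= J s x) /\ Iint (J s) = 1%E /\
     (L1norm (J s) < +oo)%E /\
     ((exists p : R, 1 < p /\ (iint (fun x => (`|J s x| `^ p)%:E) < +oo)%E)
      \/ (exists M : R, ae_Rd (fun x => `|J s x| <= M))) /\
     (iint (fun y => (Num.min 1 (enorm y ^+ 2) * J s y)%:E) < +oo)%E)
  /\
  (exists delta C0 : R, 0 < delta /\ 0 < C0 /\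
     forall s, 2^-1 < s < 1 -> forall xi : 'rV[R]_d, enorm xi <= 1 ->
       `| fourier (J s) xi - (1 - (enorm xi `^ (2 * s))%:C)%C | <=
          (C0 * enorm xi `^ (2 * s + delta))%:C%C)
  /\
  (exists (C Rr : R) (Psi : 'rV[R]_d -> R), 0 < C /\ 0 < Rr /\
     L1k 2 Psi /\
     (forall i : 'I_d, Iint (fun x => x ord0 i * Psi x) = 0%E) /\
     forall s, 2^-1 < s < 1 -> forall x : 'rV[R]_d, Rr <= enorm x ->
       J s x <= C * (1 - s) * enorm x `^ (- (d%:R) - 2 * s) + Psi x).

Definition Jeps (d : nat) (J : R -> 'rV[R]_d -> R) (s eps : R) (x : 'rV[R]_d) : R :=
  eps ^- d * J s (eps^-1 *: x).
Definition conv (d : nat) (g f : 'rV[R]_d -> R) (z : 'rV[R]_d) : R :=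
  fine (Iint (fun y => g (z - y) * f y)).
Definition Tt (d : nat) (s eps t : R) (f : 'rV[R]_d -> R) (x : 'rV[R]_d) : R :=
  expR ((d%:R - eps `^ (- (2 * s))) * t) * f (expR t *: x).

(* L*_eps phi(x) = eps^{-2s} int J_eps(y)[phi(x+y)-phi(x)] dy - x . grad phi(x);
   x . grad phi(x) is the directional derivative of phi at x in direction x. *)
Definition Lstar (d : nat) (J : R -> 'rV[R]_d -> R) (s eps : R)
    (phi : 'rV[R]_d -> R) (x : 'rV[R]_d) : \bar R :=
  ((eps `^ (- (2 * s)))%:E * Iint (fun y => (Jeps J s eps y * (phi (x + y) - phi x))%R)
   - ('D_x phi x)%:E)%E.

(* u is the mild solution (Duhamel formula) of
     d_t u = eps^{-2s}(J_eps * u - u) + div(x u),  u(0) = u0,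
   i.e. u(t) = T_t u0 + eps^{-2s} int_0^t T_{t-tau}(J_eps * u(tau)) dtau,
   in the class of jointly measurable, locally-in-time L^1-bounded functions
   (in which the mild solution is unique); u t = S_t u0. *)
Definition mild_solution (d : nat) (J : R -> 'rV[R]_d -> R) (s eps : R)
    (u0 : 'rV[R]_d -> R) (u : R -> 'rV[R]_d -> R) : Prop :=
  meas_tRd u /\
  (forall t, 0 <= t -> meas_Rd (u t)) /\
  (forall T, 0 <= T -> exists M : R, forall t, 0 <= t <= T -> (L1norm (u t) <= M%:E)%E) /\
  (forall t, 0 <= t -> ae_Rd (fun x =>
     (u t x)%:E =
       ((Tt s eps t u0 x)%:E +
        (eps `^ (- (2 * s)))%:E *
          \int[lebesgue_measure]_(tau in [set tau : R | (0 <= tau <= t)%R])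
             (Tt s eps (t - tau) (conv (Jeps J s eps) (u tau)) x)%:E)%E)).

End Defs.

(* Main.v *)
(* Write kap = eps^(-2s), Q_r psi(x) = e^(-kap r) psi(e^(-r) x) and
   K psi(y) = int J_eps(z - y) psi(z) dz.  Pairing the Duhamel formula with a weight
   psi >= 0 gives
     <psi, |u(t)|> <= <Q_t psi, |u0|> + kap int_0^t <K Q_(t-tau) psi, |u(tau)|> dtau.
   Iterating it (each time with psi = K of the previous Dyson term) only needs
   Tonelli's theorem and bounds <phi, |u(t)|> by the partial sums of the Dyson
   series of the dual semigroup applied to phi, plus a remainder.  These partial sums
   stay below every supersolution of the dual equation.  By the Lyapunov inequality,
   e^(-lam r) V + C/lam (1 - e^(-lam r)) is a supersolution when phi <= V: along the
   flow x -> e^(-r) x this is the fundamental theorem of calculus.  The moments of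
   u(t) are not known to be finite a priori, so one takes phi = min(V, n): the
   constant n is then a supersolution too, which makes the remainders summable, and
   n -> oo by monotone convergence. *)

Require Import Defs.
From HB Require Import structures.
From mathcomp Require Import all_boot all_order all_algebra.
From mathcomp Require Import all_classical all_reals all_analysis.
From mathcomp Require Import measurable_realfun.
From mathcomp Require Import complex ring lra.
Set Implicit Arguments. Unset Strict Implicit. Unset Printing Implicit Defensive.
Import Order.TTheory GRing.Theory Num.Theory numFieldNormedType.Exports.
Local Open Scope classical_set_scope.
Local Open Scope ring_scope.

(** A mild solution is only measurable, bounded in L^1 on bounded time intervals, and known to
    satisfy the Duhamel formula for almost every x at each fixed time. Nothing can be differentiated
    in time, and a Gronwall argument on [normV k (u t)] would need this quantity to be finite
    beforehand. On the dual side everything is an explicit nonnegative function, and the unknown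
    occurs only inside pairings with values in [0, +oo]. The truncation changes only the terminal
    value phi: the supersolution is still built from V, so the Lyapunov inequality is applied to V
    itself and not to min(V, n). The term C/lam (1 - e^(-lam r)) is C times the integral of e^(-lam
    q) over 0 <= q <= r; its pairing with |u0| produces the L^1 norm. No decay rate of the
    remainders is computed: their sum is at most one pairing with the constant n, which K preserves,
    and the L^1 bound makes that pairing finite. Since integrals on R^d are given as iterated
    one-dimensional integrals, a measure with the same recursion is built on row vectors, so that
    Tonelli's theorem and changes of variables apply. *)

(** * The sigma-algebra generated by the coordinates of row vectors *)

Section RowVectorMeasurable.
Context {R : realType}.
Variable n : nat.

Let coord (i : 'I_n) (x : 'rV[R]_n) : R := x ord0 i.

Let coord_set0 : g_sigma_preimage coord set0.
Proof. exact: sigma_algebra0. Qed.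

Let coord_setC A : g_sigma_preimage coord A -> g_sigma_preimage coord (~` A).
Proof. exact: sigma_algebraC. Qed.

Let coord_bigcup (F : _^nat) : (forall i, g_sigma_preimage coord (F i)) ->
  g_sigma_preimage coord (\bigcup_i (F i)).
Proof. exact: sigma_algebra_bigcup. Qed.

(** With this choice a map into row vectors is measurable as soon as its coordinates are. Its link
    with [borel_Rd] is the inclusion of the Borel sets, proved in the next part. *)
HB.instance Definition _ := @isMeasurable.Build default_measure_display
  'rV[R]_n (g_sigma_preimage coord) coord_set0 coord_setC coord_bigcup.

Lemma measurable_coord (i : 'I_n) :
  measurable_fun [set: 'rV[R]_n] (fun x : 'rV[R]_n => x ord0 i).
Proof.
move=> _ Y mY; rewrite setTI; apply: sub_sigma_algebra => /=.
rewrite -bigcup_seq/=; exists i => /=; first by rewrite mem_index_enum.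
by exists Y => //; rewrite setTI.
Qed.

Lemma measurable_fun_rowP d (T : measurableType d) (f : T -> 'rV[R]_n) :
  (forall i, measurable_fun [set: T] (fun x => f x ord0 i)) ->
  measurable_fun [set: T] f.
Proof.
move=> mf.
suff : g_sigma_preimage (fun i => coord i \o f) `<=` measurable.
  rewrite g_sigma_preimage_comp => prefS.
  by move=> _ A mA; apply: prefS; exists A.
apply: smallest_sub; first exact: sigma_algebra_measurable.
rewrite -bigcup_seq; apply: bigcup_sub => i _.
by move=> A [B mB <-]; exact: mf.
Qed.
End RowVectorMeasurable.

(** * Borel sets of R^d and of R x R^d are measurable *)

Section Borel.
Context {R : realType}.

Lemma bigcup_count_measurable d (T : measurableType d) (I : countType)
    (P : set I) (F : I -> set T) :
  (forall i, P i -> measurable (F i)) -> measurable (\bigcup_(i in P) F i).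
Proof.
move=> mF; rewrite bigcup_mkcond.
apply: countable_bigcupT_measurable => [|i]; first exact: countableP.
by case: ifPn => // /set_mem; exact: mF.
Qed.

(** An open set is the union of the balls with centre in a countable dense family and radius 1/(m+1)
    that it contains. The source carries the sigma-algebra and the target the topology, so that [h]
    can be the identity between two structures on one carrier. *)
Lemma open_measurable_dense d (T : measurableType d)
    (X : pseudoMetricType R) (I : countType) (c : I -> X) (h : T -> X) :
  (forall i m, measurable (h @^-1` ball (c i) (m.+1%:R^-1))) ->
  (forall x (e : R), 0 < e -> exists i, ball x e (c i)) ->
  forall A : set X, open A -> measurable (h @^-1` A).
Proof.
move=> mb dc A oA.
have -> : h @^-1` A = \bigcup_(p in [set p : I * nat | ball (c p.1) p.2.+1%:R^-1 `<=` A])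
    (h @^-1` ball (c p.1) p.2.+1%:R^-1).
  apply/seteqP; split => [x /= Ax|x [p /= pA] /pA //].
  have : nbhs (h x) A by exact: open_nbhs_nbhs.
  rewrite -nbhs_ballE => -[e /= e0 eA].
  (* Below e / 2, because a point of the small ball is reached from [h x] through the centre, at the
     cost of two radii. *)
  have [m _ me] : exists2 m, True & m.+1%:R^-1 < e / 2 :> R.
    have /= := near_infty_natSinv_lt (PosNum (divr_gt0 e0 (ltr0n R 2))).
    by case=> N _ /(_ N (leqnn N)) /= ?; exists N.
  have m0 : 0 < m.+1%:R^-1 :> R by rewrite invr_gt0.
  have [i xi] := dc (h x) _ m0.
  exists (i, m) => /=; last exact: ball_sym.
  move=> y cy; apply: eA; rewrite [e]splitr.
  apply: (@ball_triangle _ _ (c i)).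
    by apply: le_ball xi; exact: ltW.
  by apply: le_ball cy; exact: ltW.
apply: bigcup_count_measurable => p _; exact: mb.
Qed.

Lemma rat_dense_ball (x e : R) : 0 < e -> exists q : rat, ball x e (ratr q : R).
Proof.
move=> e0.
have /rat_in_itvoo[q] : x - e < x + e by rewrite ltrBlDr -addrA ltrDl addr_gt0.
rewrite in_itv/= => /andP[h1 h2]; exists q.
by rewrite /ball/= ltr_distlC h1 h2.
Qed.

Definition rat_row n (q : 'rV[rat]_n) : 'rV[R]_n := map_mx ratr q.

Lemma rat_row_dense n (x : 'rV[R]_n) (e : R) : 0 < e ->
  exists q : 'rV[rat]_n, ball x e (rat_row q).
Proof.
move=> e0; have h i : exists q : rat, ball (x ord0 i) e (ratr q : R).
  exact: rat_dense_ball.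
have [f fP] := choice h.
exists (\row_i f i); split => // i j; rewrite !mxE ord1; exact: fP.
Qed.

(** Balls of row vectors are those of the maximum distance, hence finite intersections of coordinate
    slabs. *)
Lemma measurable_ball_row n (x : 'rV[R]_n) (e : R) : 0 < e -> measurable (ball x e).
Proof.
move=> e0.
have -> : ball x e = \bigcap_(i in [set: 'I_n])
    ((fun y : 'rV[R]_n => y ord0 i) @^-1` ball (x ord0 i) e).
  apply/seteqP; split => [y [_ xy] i _|y xy]; first exact: xy.
  by split => // i j; rewrite ord1; exact: xy.
apply: fin_bigcap_measurable => // i _.
rewrite -[X in measurable X]setTI; apply: measurable_coord => //.
apply: open_measurable; exact: ball_open.
Qed.

Lemma borel_Rd_measurable n (A : set 'rV[R]_n) : borel_Rd A -> measurable A.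
Proof.
apply: smallest_sub; first exact: sigma_algebra_measurable.
apply: (@open_measurable_dense _ _ _ _ (@rat_row n) id) => [q m|x e e0].
  by apply: measurable_ball_row; rewrite invr_gt0.
exact: rat_row_dense.
Qed.

Lemma borel_prod_measurable n (A : set (R * 'rV[R]_n)) :
  <<s [set A : set (R * 'rV[R]_n) | open A] >> A -> measurable A.
Proof.
apply: smallest_sub; first exact: sigma_algebra_measurable.
apply: (@open_measurable_dense _ (R * 'rV[R]_n)%type (R * 'rV[R]_n)%type
   (rat * 'rV[rat]_n)%type (fun q => (ratr q.1, rat_row q.2)) id) => [q m|x e e0].
  apply: measurableX; first by apply: open_measurable; apply: ball_open; rewrite invr_gt0.
  by apply: measurable_ball_row; rewrite invr_gt0.
have [p hp] := rat_dense_ball x.1 e0; have [q hq] := rat_row_dense x.2 e0.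
by exists (p, q).
Qed.

Lemma meas_Rd_measurable_fun n (f : 'rV[R]_n -> R) :
  meas_Rd f -> measurable_fun [set: 'rV[R]_n] f.
Proof. by move=> mf _ B mB; rewrite setTI; apply: borel_Rd_measurable; exact: mf. Qed.

Lemma meas_tRd_measurable_fun n (u : R -> 'rV[R]_n -> R) :
  meas_tRd u -> measurable_fun [set: R * 'rV[R]_n] (fun p => u p.1 p.2).
Proof. by move=> mu _ B mB; rewrite setTI; apply: borel_prod_measurable; exact: mu. Qed.

End Borel.

(** * Lebesgue measure on row vectors and affine changes of variables *)

Section RowMeasure.
Context {R : realType}.

(** The same splitting into first coordinate and rest as in [iint]; the product measure is
    transported along it. *)
Definition row_cons n (p : R * 'rV[R]_n) : 'rV[R]_n.+1 :=
  row_mx (p.1%:M : 'rV[R]_1) p.2.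

Lemma row_cons0 n (p : R * 'rV[R]_n) : row_cons p ord0 ord0 = p.1.
Proof.
have -> : (ord0 : 'I_n.+1) = lshift n (ord0 : 'I_1) by apply: val_inj.
by rewrite [LHS]row_mxEl mxE.
Qed.

Lemma row_consS n (p : R * 'rV[R]_n) i :
  row_cons p ord0 (lift ord0 i) = p.2 ord0 i.
Proof.
have -> : lift ord0 i = rshift 1 i by apply: val_inj.
by rewrite [LHS]row_mxEr.
Qed.

Definition row_uncons n (x : 'rV[R]_n.+1) : R * 'rV[R]_n :=
  (x ord0 ord0, \row_i x ord0 (lift ord0 i)).

Lemma row_consK n : cancel (@row_cons n) (@row_uncons n).
Proof.
move=> [t x]; rewrite /row_uncons row_cons0; congr pair.
by apply/rowP => i; rewrite mxE row_consS.
Qed.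

Lemma measurable_row_cons n : measurable_fun setT (@row_cons n).
Proof.
apply: measurable_fun_rowP => i; case: (unliftP ord0 i) => [j ->|->].
  rewrite (_ : (fun _ => _) = (fun y : 'rV[R]_n => y ord0 j) \o snd).
    by apply: measurableT_comp => //; exact: measurable_coord.
  by apply/funext => p /=; rewrite row_consS.
rewrite (_ : (fun _ => _) = fst)//.
by apply/funext => p /=; rewrite row_cons0.
Qed.

Lemma measurable_row_uncons n : measurable_fun setT (@row_uncons n).
Proof.
apply: measurable_fun_pair; first exact: measurable_coord.
apply: measurable_fun_rowP => i.
rewrite (_ : (fun _ => _) = (fun y : 'rV[R]_n.+1 => y ord0 (lift ord0 i))).
  exact: measurable_coord.
by apply/funext => p; rewrite mxE.
Qed.

Local Open Scope ereal_scope.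

(* The library's sigma-finite instance on product measures is not inferred: its
   instance for subprobability measures shadows it. *)
Lemma sigma_finite_product d1 d2 (T1 : measurableType d1) (T2 : measurableType d2)
    (m1 : {sigma_finite_measure set T1 -> \bar R})
    (m2 : {sigma_finite_measure set T2 -> \bar R}) :
  sigma_finite [set: T1 * T2] (m1 \x m2).
Proof.
have /sigma_finiteP[F [TF ndF Foo]] := sigma_finiteT m1.
have /sigma_finiteP[G [TG ndG Goo]] := sigma_finiteT m2.
exists (fun k => F k `*` G k) => [|k].
  apply/seteqP; split => // -[x y] _.
  have : setT x by []; rewrite TF => -[i _ Fx].
  have : setT y by []; rewrite TG => -[j _ Gy].
  exists (maxn i j) => //; split => /=.
    by move: x Fx; apply/subsetPset/ndF; rewrite leq_maxl.
  by move: y Gy; apply/subsetPset/ndG; rewrite leq_maxr.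
have [[mF Fk] [mG Gk]] := (Foo k, Goo k).
by split; [exact: measurableX | rewrite product_measure1E// lte_mul_pinfty// ge0_fin_numE].
Qed.

Section pushforward_bij.
Context d1 d2 (T1 : measurableType d1) (T2 : measurableType d2).
Variables (m : {measure set T1 -> \bar R}) (f : T1 -> T2) (g : T2 -> T1).
Hypotheses (mf : measurable_fun setT f) (mg : measurable_fun setT g).
Hypotheses (fK : cancel f g) (sm : sigma_finite setT m).

(** An exhaustion of the source is pulled back along the left inverse [g]; since [g \o f] is the
    identity, its preimages under [f] are the original sets of finite measure. *)
Lemma sigma_finite_pushforward_bij : sigma_finite setT (pushforward m f).
Proof.
have [F FT Fm] := sm.
exists (fun k => g @^-1` F k).
  by rewrite -preimage_bigcup -FT preimage_setT.
move=> k; have [mF Foo] := Fm k; split.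
  by rewrite -[X in measurable X]setTI; exact: mg.
rewrite /pushforward -comp_preimage (_ : g \o f = id)//.
by apply/funext => x /=; rewrite fK.
Qed.

Definition pushforward_measure : {measure set T2 -> \bar R}.
Proof.
unshelve refine (pushforward m f : {measure set T2 -> \bar R}).
all: exact: mf.
Defined.

Definition pushforward_bij : {sigma_finite_measure set T2 -> \bar R} :=
  HB.pack (Measure.sort pushforward_measure)
    (Measure_isSigmaFinite.Build _ _ _ pushforward_measure
       sigma_finite_pushforward_bij).

End pushforward_bij.

(** Lebesgue measure on R^n, defined by the recursion of [iint]. In dimension 0 the Dirac mass
    matches the evaluation [f 0]. Sigma-finiteness is part of the type because Tonelli's theorem is
    used at every level. *)
Fixpoint row_measure n : {sigma_finite_measure set 'rV[R]_n -> \bar R} :=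
  match n with
  | 0 => \d_(0%R : 'rV[R]_0)
  | n'.+1 => @pushforward_bij _ _ (measurableTypeR R * 'rV[R]_n')%type _
      (lebesgue_measure \x row_measure n') _ _
      (@measurable_row_cons n') (@measurable_row_uncons n') (@row_consK n')
      (sigma_finite_product lebesgue_measure (row_measure n'))
  end.

Lemma ge0_integral_row_measureS n (f : 'rV[R]_n.+1 -> \bar R) :
  measurable_fun setT f -> (forall x, 0 <= f x) ->
  \int[row_measure n.+1]_x f x =
  \int[lebesgue_measure]_t \int[row_measure n]_x f (row_cons (t, x)).
Proof.
move=> mf f0; rewrite /= /pushforward_bij/=.
rewrite ge0_integral_pushforward//; last exact: measurable_row_cons.
rewrite preimage_setT fubini_tonelli1//; last by move=> p; exact: f0.
by apply: measurableT_comp => //; exact: measurable_row_cons.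
Qed.

(** Both sides obey the same recursion, the right one by Tonelli. From here on [iint] of a
    nonnegative function is an integral against a single measure. *)
Lemma iintE n (f : 'rV[R]_n -> \bar R) :
  measurable_fun setT f -> (forall x, 0 <= f x) ->
  iint f = \int[row_measure n]_x f x.
Proof.
elim: n f => [|n IH] f mf f0; first by rewrite /= integral_dirac// diracT mul1e.
rewrite ge0_integral_row_measureS//=; apply: eq_integral => t _.
rewrite IH => [//||//].
apply: (@measurableT_comp _ _ _ _ _ _ f _ (fun x => row_cons (t, x))) => //.
apply: (@measurableT_comp _ _ _ _ _ _ (@row_cons n) _ (pair t)) => //.
exact: measurable_row_cons.
Qed.

(** The image of Lebesgue measure under t -> a t + b, multiplied by a, gives each interval its
    length, so it is Lebesgue measure by uniqueness. *)
Lemma ge0_integral_affine (a b : R) (f : R -> \bar R) : (0 < a)%R ->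
  measurable_fun setT f -> (forall x, 0 <= f x) ->
  \int[lebesgue_measure]_t f (a * t + b)%R = a^-1%:E * \int[lebesgue_measure]_t f t.
Proof.
move=> a0 mf f0.
have mh : @measurable_fun _ _ (measurableTypeR R) (measurableTypeR R) setT
    (fun t : R => (a * t + b)%R).
  by apply: measurable_funD => //; exact: measurable_funM.
pose m : {measure set (measurableTypeR R) -> \bar R} :=
  pushforward_measure lebesgue_measure mh.
have a0' : (0 <= a)%R by exact: ltW.
pose m' : {measure set (measurableTypeR R) -> \bar R} := mscale (NngNum a0') m.
have e A : measurable A -> lebesgue_measure A = m' A.
  apply: lebesgue_measure_unique => X [[c d] /= cd <-].
  rewrite /m' /mscale/= /m /pushforward_measure/= /pushforward.
  rewrite (_ : _ @^-1` _ = [set` `](c - b) / a, (d - b) / a]]%R); last first.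
    apply/seteqP; split => x /=; rewrite !in_itv/=.
      by move=> /andP[h1 h2]; rewrite ltr_pdivrMr// ler_pdivlMr// [(x * a)%R]mulrC ltrBlDr lerBrDr h1 h2.
    by rewrite ltr_pdivrMr// ler_pdivlMr// [(x * a)%R]mulrC ltrBlDr lerBrDr.
  rewrite !lebesgue_measure_itv/= !lte_fin ltr_pM2r ?invr_gt0// ltrD2r.
  case: ifP => _; last by rewrite mule0.
  by rewrite -EFinB -EFinM; congr EFin; field; rewrite gt_eqF.
have -> : \int[lebesgue_measure]_t f (a * t + b)%R = \int[m]_t f t.
  by rewrite ge0_integral_pushforward.
have <- : \int[m']_t f t = \int[lebesgue_measure]_t f t.
  by apply: eq_measure_integral => A mA _; rewrite -e.
rewrite ge0_integral_mscale//= muleA -EFinM mulVf ?mul1e//.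
by rewrite gt_eqF.
Qed.

(** Induction on the dimension, each coordinate contributing one factor 1/a. Translations are the
    case a = 1, dilations the case b = 0. *)
Lemma ge0_integral_row_affine n (a : R) (b : 'rV[R]_n) (f : 'rV[R]_n -> \bar R) :
  (0 < a)%R -> measurable_fun setT f -> (forall x, 0 <= f x) ->
  \int[row_measure n]_x f (a *: x + b)%R =
  (a ^- n)%:E * \int[row_measure n]_x f x.
Proof.
move=> a0.
have maff m (c : 'rV[R]_m) : measurable_fun setT (fun x : 'rV[R]_m => (a *: x + c)%R).
  apply: measurable_fun_rowP => i.
  rewrite (_ : (fun _ => _) = fun x : 'rV[R]_m => a * x ord0 i + c ord0 i)%R.
    apply: measurable_funD => //; apply: measurable_funM => //.
    exact: measurable_coord.
  by apply/funext => x; rewrite !mxE.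
elim: n b f => [|n IH] b f mf f0.
  rewrite /= !integral_dirac//; last exact: (measurableT_comp mf (maff _ b)).
  rewrite !diracE !in_setT !mul1e invr1 mul1e.
  by congr f; apply/rowP => -[].
rewrite ge0_integral_row_measureS//; last exact: (measurableT_comp mf (maff _ b)).
have affE t x : (a *: row_cons (t, x) + b)%R =
    row_cons (a * t + b ord0 ord0, a *: x + (row_uncons b).2)%R.
  apply/rowP => i; case: (unliftP ord0 i) => [j ->|->].
    by rewrite mxE [X in (X + _)%R]mxE !row_consS !mxE.
  by rewrite mxE [X in (X + _)%R]mxE !row_cons0.
have mrow (t : R) : measurable_fun setT (fun x : 'rV[R]_n => f (row_cons (t, x))).
  apply: (@measurableT_comp _ _ _ _ _ _ f _ (fun x => row_cons (t, x))) => //.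
  apply: (@measurableT_comp _ _ _ _ _ _ (@row_cons n) _ (pair t)) => //.
  exact: measurable_row_cons.
pose F s := (a ^- n)%:E * \int[row_measure n]_x f (row_cons (s, x)).
transitivity (\int[lebesgue_measure]_t F (a * t + b ord0 ord0)%R).
  apply: eq_integral => t _; rewrite /F -(IH (row_uncons b).2)//.
  by apply: eq_integral => x _; rewrite affE.
have mF : measurable_fun setT (fun s => \int[row_measure n]_x f (row_cons (s, x))).
  apply: (measurable_fun_fubini_tonelli_F (f \o @row_cons n)) => //=.
  by apply: measurableT_comp => //; exact: measurable_row_cons.
have F0 s : 0 <= \int[row_measure n]_x f (row_cons (s, x)) by exact: integral_ge0.
have an0 : (0 <= a ^- n)%R by rewrite invr_ge0 exprn_ge0 // ltW.
rewrite ge0_integral_affine//; first last.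
  by move=> x; rewrite mule_ge0.
  exact: emeasurable_funM.
rewrite /F ge0_integralZl_EFin// ge0_integral_row_measureS// muleA -EFinM.
by rewrite exprS invfM.
Qed.

End RowMeasure.

(** * Joint measurability, Tonelli's theorem and indicators of time intervals *)

Section Tools.
Local Open Scope ereal_scope.
Context {R : realType}.

Lemma measurable_fun2 d d1 d2 d3 (X : measurableType d) (T1 : measurableType d1)
    (T2 : measurableType d2) (Z : measurableType d3) (F : T1 -> T2 -> Z)
    (a : X -> T1) (b : X -> T2) :
  measurable_fun [set: T1 * T2] (fun p => F p.1 p.2) ->
  measurable_fun setT a -> measurable_fun setT b ->
  measurable_fun setT (fun x => F (a x) (b x)).
Proof.
move=> mF ma mb.
apply: (@measurableT_comp _ _ _ _ _ _ (fun p => F p.1 p.2) _ (fun x => (a x, b x))) => //.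
exact: measurable_fun_pair.
Qed.

Lemma measurable_section d (T : measurableType d) (F : R -> T -> \bar R) (s : R) :
  measurable_fun [set: R * T] (fun p => F p.1 p.2) -> measurable_fun setT (F s).
Proof. by move=> mF; apply: (@measurable_fun2 _ _ _ _ _ _ _ _ F). Qed.

Lemma measurable_ge0_integral d1 d2 (T1 : measurableType d1) (T2 : measurableType d2)
    (m : {sigma_finite_measure set T2 -> \bar R}) (f : T1 -> T2 -> \bar R) :
  measurable_fun [set: T1 * T2] (fun p => f p.1 p.2) -> (forall x y, 0 <= f x y) ->
  measurable_fun setT (fun x => \int[m]_y f x y).
Proof.
by move=> mf f0; apply: (measurable_fun_fubini_tonelli_F (fun p => f p.1 p.2)).
Qed.

Lemma ge0_integral_swap d1 d2 (T1 : measurableType d1) (T2 : measurableType d2)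
    (m1 : {sigma_finite_measure set T1 -> \bar R})
    (m2 : {sigma_finite_measure set T2 -> \bar R}) (f : T1 -> T2 -> \bar R) :
  measurable_fun [set: T1 * T2] (fun p => f p.1 p.2) -> (forall x y, 0 <= f x y) ->
  \int[m1]_x \int[m2]_y f x y = \int[m2]_y \int[m1]_x f x y.
Proof. by move=> mf f0; apply: (fubini_tonelli (fun p => f p.1 p.2)). Qed.

Lemma measurable_rowZ d (X : measurableType d) n (a : X -> R) (f : X -> 'rV[R]_n) :
  measurable_fun setT a -> measurable_fun setT f ->
  measurable_fun setT (fun x => a x *: f x)%R.
Proof.
move=> ma mf; apply: measurable_fun_rowP => i.
rewrite (_ : (fun _ => _) = (fun x => a x * f x ord0 i)%R); last first.
  by apply/funext => x; rewrite mxE.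
apply: measurable_funM => //.
by apply: (@measurableT_comp _ _ _ _ _ _ (fun y : 'rV[R]_n => y ord0 i)) => //; exact: measurable_coord.
Qed.

Lemma measurable_rowB d (X : measurableType d) n (f g : X -> 'rV[R]_n) :
  measurable_fun setT f -> measurable_fun setT g ->
  measurable_fun setT (fun x => f x - g x)%R.
Proof.
move=> mf mg; apply: measurable_fun_rowP => i.
rewrite (_ : (fun _ => _) = (fun x => f x ord0 i - g x ord0 i)%R); last first.
  by apply/funext => x; rewrite !mxE.
by apply: measurable_funB;
  apply: (@measurableT_comp _ _ _ _ _ _ (fun y : 'rV[R]_n => y ord0 i)) => //; exact: measurable_coord.
Qed.

(** Integrals over time intervals with moving end points are written over the whole line with this
    factor, so that the end points can be variables in Tonelli's theorem. *)
Definition between (a b c : R) : \bar R := ((a <= b <= c)%R%:R)%:E.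

Lemma between_ge0 a b c : 0 <= between a b c.
Proof. by rewrite lee_fin. Qed.

Lemma measurable_between d (X : measurableType d) (a b c : X -> R) :
  measurable_fun setT a -> measurable_fun setT b -> measurable_fun setT c ->
  measurable_fun setT (fun x => between (a x) (b x) (c x)).
Proof.
move=> ma mb mc; apply/measurable_EFinP.
rewrite (_ : (fun _ => _) = (fun x => if (a x <= b x <= c x)%R then 1 else 0)%R).
  apply: measurable_fun_ifT => //.
  by apply: measurable_and; exact: measurable_fun_ler.
by apply/funext => x; case: ifP.
Qed.

(** Both sides are the indicator of 0 <= s1 <= s2 <= t. The two factorizations correspond to the two
    orders of integration over this triangle. *)
Lemma between_split (s1 s2 t : R) :
  between 0 s2 t * between 0 s1 s2 = between 0 s1 t * between s1 s2 t.
Proof.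
rewrite /between -!EFinM; congr EFin.
case: (lerP 0 s1) => h1; case: (lerP s1 s2) => h2; case: (lerP s2 t) => h3 /=;
  rewrite ?andbF ?mulr0 ?mul0r //=.
- by rewrite (le_trans h1 h2) (le_trans h2 h3).
Qed.

End Tools.

(** * The dual operators and one step of the Dyson iteration *)

Section DualIteration.
Local Open Scope ereal_scope.
Context {R : realType} (d : nat).
Notation T := 'rV[R]_d.
Notation mu := (@row_measure R d).
Notation leb := (@lebesgue_measure R).
Variables (g : T -> R) (kap : R).
Hypotheses (mg : measurable_fun setT g) (g0 : forall x, (0 <= g x)%R) (kap0 : (0 <= kap)%R).

(** Weights take values in [\bar R]: for nonnegative ones all integrals make sense in [0, +oo], and
    no integrability has to be carried along. *)
Definition Kop (psi : T -> \bar R) (y : T) := \int[mu]_z ((g (z - y))%:E * psi z).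
Definition Qop (r : R) (psi : T -> \bar R) (x : T) :=
  (expR (- kap * r))%:E * psi (expR (- r) *: x)%R.
Definition pairing (psi : T -> \bar R) (h : T -> R) := \int[mu]_x (psi x * (h x)%:E).

Lemma Kop_ge0 (psi : T -> \bar R) y : (forall x, 0 <= psi x) -> 0 <= Kop psi y.
Proof. by move=> p0; apply: integral_ge0 => z _; rewrite mule_ge0// lee_fin. Qed.

Lemma Qop_ge0 r (psi : T -> \bar R) x : (forall x, 0 <= psi x) -> 0 <= Qop r psi x.
Proof. by move=> p0; rewrite mule_ge0// lee_fin expR_ge0. Qed.

Lemma pairing_ge0 (psi : T -> \bar R) (h : T -> R) : (forall x, 0 <= psi x) -> (forall x, (0 <= h x)%R) ->
  0 <= pairing psi h.
Proof. by move=> p0 h0; apply: integral_ge0 => z _; rewrite mule_ge0// lee_fin. Qed.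

(** The parameter [Y] stands for a time or a pair of times: weights vary with time, and exchanging
    integrals requires measurability in time and space jointly. *)
Lemma measurable_Kop d' (Y : measurableType d') (Psi : Y -> T -> \bar R) :
  measurable_fun [set: Y * T] (fun p => Psi p.1 p.2) ->
  (forall y x, 0 <= Psi y x) ->
  measurable_fun [set: Y * T] (fun p => Kop (Psi p.1) p.2).
Proof.
move=> mP P0.
apply: (@measurable_ge0_integral _ _ _ _ _ mu
  (fun (p : Y * T) z => (g (z - p.2))%:E * Psi p.1 z)); last first.
  by move=> p z; rewrite mule_ge0// lee_fin.
apply: emeasurable_funM.
  apply/measurable_EFinP; apply: (@measurableT_comp _ _ _ _ _ _ g) => //.
  apply: measurable_rowB => //.
  exact: (measurableT_comp measurable_snd measurable_fst).
apply: (@measurable_fun2 _ _ _ _ _ _ _ _ Psi) => //.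
exact: (measurableT_comp measurable_fst measurable_fst).
Qed.

Lemma measurable_Qop d' (Y : measurableType d') (r : Y -> R) (Psi : Y -> T -> \bar R) :
  measurable_fun setT r ->
  measurable_fun [set: Y * T] (fun p => Psi p.1 p.2) ->
  measurable_fun [set: Y * T] (fun p => Qop (r p.1) (Psi p.1) p.2).
Proof.
move=> mr mP.
have mr1 : measurable_fun [set: Y * T] (fun p => r p.1).
  exact: (measurableT_comp mr measurable_fst).
apply: emeasurable_funM.
  apply/measurable_EFinP; apply: (measurableT_comp (@measurable_expR R)).
  exact: measurable_funM.
apply: (@measurable_fun2 _ _ _ _ _ _ _ _ Psi) => //.
apply: measurable_rowZ => //.
apply: (measurableT_comp (@measurable_expR R)).
exact: measurable_funN.
Qed.

Lemma measurable_Kop1 (psi : T -> \bar R) : measurable_fun setT psi -> (forall x, 0 <= psi x) ->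
  measurable_fun setT (Kop psi).
Proof.
move=> mp p0.
apply: (@measurable_fun2 _ _ _ _ _ _ _ _ (fun (_ : unit) => Kop psi) (fun=> tt) id) => //.
apply: (@measurable_Kop _ _ (fun=> psi)) => //.
exact: (measurableT_comp mp measurable_snd).
Qed.

Lemma measurable_Qop1 r (psi : T -> \bar R) : measurable_fun setT psi -> measurable_fun setT (Qop r psi).
Proof.
move=> mp.
apply: (@measurable_fun2 _ _ _ _ _ _ _ _ (fun (_ : unit) => Qop r psi) (fun=> tt) id) => //.
apply: (@measurable_Qop _ _ (fun=> r) (fun=> psi)) => //.
exact: (measurableT_comp mp measurable_snd).
Qed.

Lemma Kop_le (psi1 psi2 : T -> \bar R) y : measurable_fun setT psi1 -> measurable_fun setT psi2 ->
  (forall x, 0 <= psi1 x) -> (forall x, psi1 x <= psi2 x) -> Kop psi1 y <= Kop psi2 y.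
Proof.
move=> m1 m2 p0 p12.
have mgy : measurable_fun setT (fun z : T => (g (z - y))%:E).
  apply/measurable_EFinP; apply: (measurableT_comp mg).
  exact: measurable_rowB.
apply: ge0_le_integral => //.
- by move=> z _; rewrite mule_ge0// lee_fin.
- exact: emeasurable_funM.
- exact: emeasurable_funM.
- by move=> z _; rewrite lee_wpmul2l// lee_fin.
Qed.

Lemma pairing_le (psi1 psi2 : T -> \bar R) (h : T -> R) : measurable_fun setT psi1 -> measurable_fun setT psi2 ->
  measurable_fun setT h -> (forall x, (0 <= h x)%R) ->
  (forall x, 0 <= psi1 x) -> (forall x, psi1 x <= psi2 x) ->
  pairing psi1 h <= pairing psi2 h.
Proof.
move=> m1 m2 mh h0 p0 p12.
have mh' : measurable_fun setT (EFin \o h) by exact/measurable_EFinP.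
apply: ge0_le_integral => //.
- by move=> z _; rewrite mule_ge0// lee_fin.
- exact: emeasurable_funM.
- exact: emeasurable_funM.
- by move=> z _; rewrite lee_wpmul2r// lee_fin.
Qed.

Lemma Kop_integral d' (Y : measurableType d') (m : {sigma_finite_measure set Y -> \bar R})
    (Psi : Y -> T -> \bar R)  (y : T) :
  measurable_fun [set: Y * T] (fun p => Psi p.1 p.2) -> (forall t x, 0 <= Psi t x) ->
  Kop (fun z => \int[m]_t Psi t z) y = \int[m]_t Kop (Psi t) y.
Proof.
move=> mP P0; rewrite /Kop.
rewrite (@ge0_integral_swap _ _ _ _ _ m mu (fun t z => (g (z - y))%:E * Psi t z)).
- apply: eq_integral => z _; rewrite ge0_integralZl// ?lee_fin//.
  by apply: (@measurable_fun2 _ _ _ _ _ _ _ _ Psi).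
- apply: emeasurable_funM => //.
  apply/measurable_EFinP; apply: (@measurableT_comp _ _ _ _ _ _ g) => //.
  exact: measurable_rowB.
- by move=> t z; rewrite mule_ge0// lee_fin.
Qed.

Lemma pairing_integral d' (Y : measurableType d') (m : {sigma_finite_measure set Y -> \bar R})
    (Psi : Y -> T -> \bar R) (h : T -> R) :
  measurable_fun [set: Y * T] (fun p => Psi p.1 p.2) -> (forall t x, 0 <= Psi t x) ->
  measurable_fun setT h -> (forall x, (0 <= h x)%R) ->
  pairing (fun z => \int[m]_t Psi t z) h = \int[m]_t pairing (Psi t) h.
Proof.
move=> mP P0 mh h0; rewrite /pairing.
rewrite (@ge0_integral_swap _ _ _ _ _ m mu (fun t z => Psi t z * (h z)%:E)).
- apply: eq_integral => z _; rewrite ge0_integralZr// ?lee_fin//.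
  by apply: (@measurable_fun2 _ _ _ _ _ _ _ _ Psi).
- apply: emeasurable_funM => //.
  by apply/measurable_EFinP; apply: (@measurableT_comp _ _ _ _ _ _ h).
- by move=> t z; rewrite mule_ge0// lee_fin.
Qed.

Lemma KopZ (c : \bar R) (psi : T -> \bar R) y : 0 <= c -> measurable_fun setT psi ->
  (forall x, 0 <= psi x) -> Kop (fun z => c * psi z) y = c * Kop psi y.
Proof.
move=> c0 mp p0; rewrite /Kop -ge0_integralZl//.
- by apply: eq_integral => z _; rewrite muleCA.
- apply: emeasurable_funM => //.
  apply/measurable_EFinP; apply: (@measurableT_comp _ _ _ _ _ _ g) => //.
  exact: measurable_rowB.
- by move=> z _; rewrite mule_ge0// lee_fin.
Qed.

Lemma pairingZ (c : \bar R) (psi : T -> \bar R) (h : T -> R) : 0 <= c -> measurable_fun setT psi ->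
  measurable_fun setT h -> (forall x, (0 <= h x)%R) ->
  (forall x, 0 <= psi x) -> pairing (fun z => c * psi z) h = c * pairing psi h.
Proof.
move=> c0 mp mh h0 p0; rewrite /pairing -ge0_integralZl//.
- by apply: eq_integral => z _; rewrite muleA.
- by apply: emeasurable_funM => //; apply/measurable_EFinP.
- by move=> z _; rewrite mule_ge0// lee_fin.
Qed.

Lemma measurable_pairing d' (Y : measurableType d') (Psi : Y -> T -> \bar R) (h : Y -> T -> R) :
  measurable_fun [set: Y * T] (fun p => Psi p.1 p.2) -> (forall t x, 0 <= Psi t x) ->
  measurable_fun [set: Y * T] (fun p => h p.1 p.2) -> (forall t x, (0 <= h t x)%R) ->
  measurable_fun setT (fun y => pairing (Psi y) (h y)).
Proof.
move=> mP P0 mh h0.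
apply: (@measurable_ge0_integral _ _ _ _ _ mu (fun y z => Psi y z * (h y z)%:E)).
  by apply: emeasurable_funM => //; apply/measurable_EFinP.
by move=> y z; rewrite mule_ge0// lee_fin.
Qed.

Lemma KopD (psi1 psi2 : T -> \bar R) y :
  measurable_fun setT psi1 -> measurable_fun setT psi2 ->
  (forall x, 0 <= psi1 x) -> (forall x, 0 <= psi2 x) ->
  Kop (fun x => psi1 x + psi2 x) y = Kop psi1 y + Kop psi2 y.
Proof.
move=> m1 m2 p1 p2.
have mgy : measurable_fun setT (fun z : T => (g (z - y))%:E).
  by apply/measurable_EFinP; apply: (measurableT_comp mg); exact: measurable_rowB.
rewrite /Kop -ge0_integralD//.
- by apply: eq_integral => z _; rewrite ge0_muleDr.
- by move=> z _; rewrite mule_ge0// lee_fin.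
- exact: emeasurable_funM.
- by move=> z _; rewrite mule_ge0// lee_fin.
- exact: emeasurable_funM.
Qed.

Lemma pairingD (psi1 psi2 : T -> \bar R) (h : T -> R) :
  measurable_fun setT psi1 -> measurable_fun setT psi2 ->
  measurable_fun setT h -> (forall x, (0 <= h x)%R) ->
  (forall x, 0 <= psi1 x) -> (forall x, 0 <= psi2 x) ->
  pairing (fun x => psi1 x + psi2 x) h = pairing psi1 h + pairing psi2 h.
Proof.
move=> m1 m2 mh h0 p1 p2.
have me : measurable_fun setT (EFin \o h) by exact/measurable_EFinP.
rewrite /pairing -ge0_integralD//.
- by apply: eq_integral => z _; rewrite ge0_muleDl.
- by move=> z _; rewrite mule_ge0// lee_fin.
- exact: emeasurable_funM.
- by move=> z _; rewrite mule_ge0// lee_fin.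
- exact: emeasurable_funM.
Qed.

Variable t : R.

(** The Duhamel integral of the dual equation, run backwards from the fixed time [t]: K acts at the
    later time [tau] and Q carries the result back to [sig]. *)
Definition dyson_step (F : R -> T -> \bar R) (sig : R) (x : T) : \bar R :=
  kap%:E * \int[leb]_tau (between sig tau t * Qop (tau - sig) (Kop (F tau)) x).

Lemma measurable_dyson_integrand (F : R -> T -> \bar R) :
  measurable_fun [set: R * T] (fun p => F p.1 p.2) -> (forall s x, 0 <= F s x) ->
  measurable_fun [set: (R * T) * R]
    (fun p => between p.1.1 p.2 t * Qop (p.2 - p.1.1) (Kop (F p.2)) p.1.2).
Proof.
move=> mF F0.
have m11 : measurable_fun [set: (R * T) * R] (fun p => p.1.1).
  exact: (measurableT_comp measurable_fst measurable_fst).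
have m12 : measurable_fun [set: (R * T) * R] (fun p => p.1.2).
  exact: (measurableT_comp measurable_snd measurable_fst).
apply: emeasurable_funM; first exact: measurable_between.
have mQ : measurable_fun [set: (R * R) * T]
    (fun p => Qop (p.1.2 - p.1.1) (Kop (F p.1.2)) p.2).
  apply: (@measurable_Qop _ (R * R)%type (fun q => q.2 - q.1)%R (fun q => Kop (F q.2))).
    exact: measurable_funB.
  apply: (@measurable_fun2 _ _ _ _ _ _ _ _ (fun s => Kop (F s))) => //.
    exact: measurable_Kop.
  exact: (measurableT_comp measurable_snd measurable_fst).
apply: (@measurable_fun2 _ _ _ _ _ _ _ _ (fun q : R * R => Qop (q.2 - q.1) (Kop (F q.2)))
  (fun p : (R * T) * R => (p.1.1, p.2)) (fun p => p.1.2)) => //.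
exact: measurable_fun_pair.
Qed.

Lemma dyson_step_ge0 (F : R -> T -> \bar R) sig x : (forall s x, 0 <= F s x) ->
  0 <= dyson_step F sig x.
Proof.
move=> F0; rewrite mule_ge0// ?lee_fin//; apply: integral_ge0 => tau _.
rewrite mule_ge0// ?between_ge0//; apply: Qop_ge0 => y; exact: Kop_ge0.
Qed.

Lemma measurable_dyson_step (F : R -> T -> \bar R) :
  measurable_fun [set: R * T] (fun p => F p.1 p.2) -> (forall s x, 0 <= F s x) ->
  measurable_fun [set: R * T] (fun p => dyson_step F p.1 p.2).
Proof.
move=> mF F0; apply: measurable_funeM.
apply: (@measurable_ge0_integral _ _ _ _ _ leb (fun (p : R * T) tau =>
  between p.1 tau t * Qop (tau - p.1) (Kop (F tau)) p.2)).
  exact: measurable_dyson_integrand.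
move=> p tau; rewrite mule_ge0// ?between_ge0//; apply: Qop_ge0 => y.
exact: Kop_ge0.
Qed.

Let measurable_step_integrand (F : R -> T -> \bar R) sig x :
  measurable_fun [set: R * T] (fun p => F p.1 p.2) -> (forall s x, 0 <= F s x) ->
  measurable_fun setT (fun tau => between sig tau t * Qop (tau - sig) (Kop (F tau)) x).
Proof.
move=> mF F0; apply: (@measurable_fun2 _ _ _ _ _ _ _ _
  (fun (p : R * T) tau => between p.1 tau t * Qop (tau - p.1) (Kop (F tau)) p.2)
  (fun=> (sig, x)) id) => //.
exact: measurable_dyson_integrand.
Qed.

Lemma dyson_stepD (F G : R -> T -> \bar R) sig x :
  measurable_fun [set: R * T] (fun p => F p.1 p.2) -> (forall s x, 0 <= F s x) ->
  measurable_fun [set: R * T] (fun p => G p.1 p.2) -> (forall s x, 0 <= G s x) ->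
  dyson_step (fun s x => F s x + G s x) sig x = dyson_step F sig x + dyson_step G sig x.
Proof.
move=> mF F0 mG G0.
rewrite /dyson_step -ge0_muleDr; last 2 first.
- apply: integral_ge0 => tau _; rewrite mule_ge0// ?between_ge0//.
  by apply: Qop_ge0 => y; exact: Kop_ge0.
- apply: integral_ge0 => tau _; rewrite mule_ge0// ?between_ge0//.
  by apply: Qop_ge0 => y; exact: Kop_ge0.
congr (_ * _); rewrite -ge0_integralD//.
- apply: eq_integral => tau _; rewrite /Qop KopD//; [|exact: measurable_section..].
  rewrite ge0_muleDr; [|exact: Kop_ge0|exact: Kop_ge0].
  rewrite ge0_muleDr// mule_ge0// ?lee_fin ?expR_ge0//; exact: Kop_ge0.
- move=> tau _; rewrite mule_ge0// ?between_ge0//.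
  by apply: Qop_ge0 => y; exact: Kop_ge0.
- exact: measurable_step_integrand.
- move=> tau _; rewrite mule_ge0// ?between_ge0//.
  by apply: Qop_ge0 => y; exact: Kop_ge0.
- exact: measurable_step_integrand.
Qed.

(** The integrand vanishes for tau > t, so a comparison at times up to [t] is enough;
    [supersolution] constrains exactly these times. *)
Lemma dyson_step_le (F G : R -> T -> \bar R) sig x :
  measurable_fun [set: R * T] (fun p => F p.1 p.2) -> (forall s x, 0 <= F s x) ->
  measurable_fun [set: R * T] (fun p => G p.1 p.2) -> (forall s x, 0 <= G s x) ->
  (forall s x, (s <= t)%R -> F s x <= G s x) ->
  dyson_step F sig x <= dyson_step G sig x.
Proof.
move=> mF F0 mG G0 FG; rewrite /dyson_step lee_wpmul2l ?lee_fin//.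
apply: ge0_le_integral => //.
- move=> tau _; rewrite mule_ge0// ?between_ge0//.
  by apply: Qop_ge0 => y; exact: Kop_ge0.
- exact: measurable_step_integrand.
- exact: measurable_step_integrand.
move=> tau _; have [tt|tt] := leP tau t; last first.
  by rewrite /between (leNgt tau t) tt andbF !mul0e.
rewrite lee_wpmul2l ?between_ge0// lee_wpmul2l ?lee_fin ?expR_ge0//.
apply: Kop_le => // [||z]; [exact: measurable_section..|exact: FG].
Qed.

Lemma Kop_dyson_step (F : R -> T -> \bar R) sig y :
  measurable_fun [set: R * T] (fun p => F p.1 p.2) -> (forall s x, 0 <= F s x) ->
  Kop (dyson_step F sig) y = kap%:E *
    \int[leb]_tau (between sig tau t * Kop (Qop (tau - sig) (Kop (F tau))) y).
Proof.
move=> mF F0.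
have mI : measurable_fun [set: R * T]
    (fun p => between sig p.1 t * Qop (p.1 - sig) (Kop (F p.1)) p.2).
  apply: (@measurable_fun2 _ _ _ _ _ _ _ _
    (fun (p : R * T) tau => between p.1 tau t * Qop (tau - p.1) (Kop (F tau)) p.2)
    (fun p : R * T => (sig, p.2)) fst) => //.
    exact: measurable_dyson_integrand.
  exact: measurable_fun_pair.
have I0 tau x : 0 <= between sig tau t * Qop (tau - sig) (Kop (F tau)) x.
  rewrite mule_ge0// ?between_ge0//; apply: Qop_ge0 => z; exact: Kop_ge0.
have mS : measurable_fun setT (fun x => \int[leb]_tau (between sig tau t * Qop (tau - sig) (Kop (F tau)) x)).
  apply: (@measurable_ge0_integral _ _ _ _ _ leb (fun x tau =>
    between sig tau t * Qop (tau - sig) (Kop (F tau)) x)) => //.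
  by apply: (@measurable_fun2 _ _ _ _ _ _ _ _
    (fun tau x => between sig tau t * Qop (tau - sig) (Kop (F tau)) x) snd fst).
rewrite [LHS]KopZ ?lee_fin//; last by move=> x; apply: integral_ge0.
rewrite (@Kop_integral _ _ leb (fun tau x => between sig tau t * Qop (tau - sig) (Kop (F tau)) x))//.
congr (_ * _); apply: eq_integral => tau _; rewrite KopZ ?between_ge0//.
  by apply: measurable_Qop1; apply: measurable_Kop1 => //; exact: measurable_section.
by move=> x; apply: Qop_ge0 => z; exact: Kop_ge0.
Qed.

Lemma pairing_dyson_step (F : R -> T -> \bar R) (h : T -> R) :
  measurable_fun [set: R * T] (fun p => F p.1 p.2) -> (forall s x, 0 <= F s x) ->
  measurable_fun setT h -> (forall x, (0 <= h x)%R) ->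
  pairing (dyson_step F 0) h = kap%:E *
    \int[leb]_tau (between 0 tau t * pairing (Qop tau (Kop (F tau))) h).
Proof.
move=> mF F0 mh h0.
have mI : measurable_fun [set: R * T]
    (fun p => between 0 p.1 t * Qop (p.1 - 0) (Kop (F p.1)) p.2).
  apply: (@measurable_fun2 _ _ _ _ _ _ _ _
    (fun (p : R * T) tau => between p.1 tau t * Qop (tau - p.1) (Kop (F tau)) p.2)
    (fun p : R * T => (0%R, p.2)) fst) => //.
    exact: measurable_dyson_integrand.
  exact: measurable_fun_pair.
have I0 tau x : 0 <= between 0 tau t * Qop (tau - 0) (Kop (F tau)) x.
  rewrite mule_ge0// ?between_ge0//; apply: Qop_ge0 => z; exact: Kop_ge0.
have mS : measurable_fun setT (fun x => \int[leb]_tau (between 0 tau t * Qop (tau - 0) (Kop (F tau)) x)).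
  apply: (@measurable_ge0_integral _ _ _ _ _ leb (fun x tau =>
    between 0 tau t * Qop (tau - 0) (Kop (F tau)) x)) => //.
  by apply: (@measurable_fun2 _ _ _ _ _ _ _ _
    (fun tau x => between 0 tau t * Qop (tau - 0) (Kop (F tau)) x) snd fst).
rewrite [LHS]pairingZ ?lee_fin//; last by move=> x; apply: integral_ge0.
rewrite (@pairing_integral _ _ leb (fun tau x => between 0 tau t * Qop (tau - 0) (Kop (F tau)) x))//.
congr (_ * _); apply: eq_integral => tau _; rewrite pairingZ ?between_ge0 ?subr0//.
  by apply: measurable_Qop1; apply: measurable_Kop1 => //; exact: measurable_section.
by move=> x; apply: Qop_ge0 => z; exact: Kop_ge0.
Qed.

End DualIteration.

(** * Iterating the Duhamel inequality and comparing with supersolutions *)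

(** If a > b, every [r n] is at least the fixed gap a - b, so the partial sums grow linearly and
    pass the finite bound [c]. *)
Lemma le_of_summable_excess (R : realType) (a b c : \bar R) (r : nat -> \bar R) :
  (0 <= a)%E -> (0 <= b)%E -> (forall n, 0 <= r n)%E ->
  (forall n, \sum_(j < n) r j <= c)%E -> (c < +oo)%E ->
  (forall n, a <= b + r n)%E -> (a <= b)%E.
Proof.
move=> a0 b0 r0 rs c_fin h.
have c0 : (0 <= c)%E by have := rs 0%N; rewrite big_ord0.
have [->|b_fin] := eqVneq b +oo%E; first by rewrite leey.
have {}b_fin : b \is a fin_num by rewrite ge0_fin_numE// ltey.
have rfin n : (r n < +oo)%E.
  by apply: le_lt_trans c_fin; apply: le_trans (rs n.+1); rewrite big_ord_recr/= leeDr// sume_ge0.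
have a_fin : a \is a fin_num.
  rewrite ge0_fin_numE//; apply: (le_lt_trans (h 0%N)).
  by rewrite lte_add_pinfty// ltey_eq b_fin.
rewrite leNgt; apply/negP => lt.
pose e := fine a - fine b.
have e0 : 0 < e by rewrite subr_gt0 -lte_fin !fineK.
have re n : (e%:E <= r n)%E by rewrite /e EFinB !fineK// leeBlDl.
have cf : c \is a fin_num by rewrite ge0_fin_numE.
have hn n : n%:R * e <= fine c.
  rewrite -lee_fin fineK//; apply: le_trans (rs n).
  elim: n => [|n IH]; first by rewrite mul0r big_ord0.
  by rewrite big_ord_recr/= -addn1 natrD mulrDl mul1r EFinD leeD.
have := hn (Num.truncn (fine c / e)).+1; apply/negP; rewrite -ltNge.
by rewrite -ltr_pdivrMr// Num.Theory.truncnS_gt.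
Qed.

Section Comparison.
Local Open Scope ereal_scope.
Context {R : realType} (d : nat).
Notation T := 'rV[R]_d.
Notation mu := (@row_measure R d).
Notation leb := (@lebesgue_measure R).
Variables (g : T -> R) (kap : R).
Hypotheses (mg : measurable_fun setT g) (g0 : forall x, (0 <= g x)%R) (kap0 : (0 <= kap)%R).
Variables (f : R -> T -> R) (f_ini : T -> R).
Hypotheses (mf : measurable_fun [set: R * T] (fun p => f p.1 p.2))
  (f0 : forall s x, (0 <= f s x)%R)
  (mf_ini : measurable_fun setT f_ini) (f_ini0 : forall x, (0 <= f_ini x)%R).
(** The only form in which the equation enters this part. It is required at all times and for all
    weights because the iteration applies it at intermediate times to weights produced by earlier
    steps. *)
Hypothesis duhamel : forall (tau : R) (psi : T -> \bar R), (0 <= tau)%R ->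
  measurable_fun setT psi -> (forall x, 0 <= psi x) ->
  pairing psi (f tau) <= pairing (Qop kap tau psi) f_ini +
    kap%:E * \int[leb]_sig (between 0 sig tau *
       pairing (Kop g (Qop kap (tau - sig) psi)) (f sig)).
Variable t : R.
Hypothesis t0 : (0 <= t)%R.

Let mfs s : measurable_fun setT (f s).
Proof. by apply: (@measurable_fun2 _ _ _ _ _ _ _ _ f). Qed.

(** The part of the iteration still to be expanded when [F] is the last Dyson term: it alone
    involves the unknown at intermediate times. *)
Definition remainder (F : R -> T -> \bar R) : \bar R :=
  kap%:E * \int[leb]_tau (between 0 tau t * pairing (Kop g (F tau)) (f tau)).

Let measurable_remainder (F : R -> T -> \bar R) :
  measurable_fun [set: R * T] (fun p => F p.1 p.2) -> (forall s x, 0 <= F s x) ->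
  measurable_fun setT (fun tau => between 0 tau t * pairing (Kop g (F tau)) (f tau)).
Proof.
move=> mF F0; apply: emeasurable_funM; first exact: measurable_between.
apply: (@measurable_pairing _ _ _ _ (fun tau => Kop g (F tau)) f) => //.
  exact: measurable_Kop.
by move=> *; exact: Kop_ge0.
Qed.

Lemma remainder_ge0 F : (forall s x, 0 <= F s x) -> 0 <= remainder F.
Proof.
move=> F0; rewrite mule_ge0// ?lee_fin//; apply: integral_ge0 => tau _.
by rewrite mule_ge0 ?between_ge0//; apply: pairing_ge0 => // x; exact: Kop_ge0.
Qed.

(** The Duhamel inequality at time tau with weight K F(tau) is inserted under the integral. Its
    initial-data term pairs the next Dyson term with [f_ini]; its time integral gives a double
    integral over 0 <= sig <= tau <= t, which in the other order is the next remainder. *)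
Lemma remainder_step (F : R -> T -> \bar R) :
  measurable_fun [set: R * T] (fun p => F p.1 p.2) -> (forall s x, 0 <= F s x) ->
  remainder F <= pairing (dyson_step g kap t F 0) f_ini + remainder (dyson_step g kap t F).
Proof.
move=> mF F0.
pose Psi tau := Kop g (F tau).
have mPsi : measurable_fun [set: R * T] (fun p => Psi p.1 p.2) by exact: measurable_Kop.
have Psi0 s x : 0 <= Psi s x by exact: Kop_ge0.
pose P sig tau := pairing (Kop g (Qop kap (tau - sig) (Psi tau))) (f sig).
have KQ0 s r x : 0 <= Kop g (Qop kap r (Psi s)) x.
  by apply: Kop_ge0 => // y; exact: Qop_ge0.
have P0 sig tau : 0 <= P sig tau by apply: pairing_ge0.
have mKQ : measurable_fun [set: (R * R) * T]
    (fun p => Kop g (Qop kap (p.1.2 - p.1.1) (Psi p.1.2)) p.2).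
  apply: (@measurable_Kop _ _ _ mg g0 _ _ (fun q : R * R => Qop kap (q.2 - q.1) (Psi q.2))).
    apply: (@measurable_Qop _ _ _ _ (R * R)%type (fun q => q.2 - q.1)%R (fun q => Psi q.2)).
      exact: measurable_funB.
    apply: (@measurable_fun2 _ _ _ _ _ _ _ _ Psi) => //.
    exact: (measurableT_comp measurable_snd measurable_fst).
  by move=> *; exact: Qop_ge0.
have mP : measurable_fun [set: R * R] (fun q => P q.1 q.2).
  apply: (@measurable_pairing _ _ _ _ (fun q : R * R => Kop g (Qop kap (q.2 - q.1) (Psi q.2)))
    (fun q => f q.1)) => //.
  apply: (@measurable_fun2 _ _ _ _ _ _ _ _ f) => //.
  exact: (measurableT_comp measurable_fst measurable_fst).
(* The later time tau is put outside, so that the final comparison can be made for each tau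
   separately. *)
have remE : remainder (dyson_step g kap t F) = kap%:E * \int[leb]_tau \int[leb]_sig
    (kap%:E * (between 0 tau t * between 0 sig tau * P sig tau)).
  congr (_ * _).
  rewrite (@ge0_integral_swap _ _ _ _ _ leb leb (fun tau sig =>
    kap%:E * (between 0 tau t * between 0 sig tau * P sig tau))); last 2 first.
  - apply: measurable_funeM; apply: emeasurable_funM.
      by apply: emeasurable_funM; exact: measurable_between.
    by apply: (@measurable_fun2 _ _ _ _ _ _ _ _ P).
  - by move=> tau sig; rewrite !mule_ge0 ?between_ge0 ?lee_fin.
  apply: eq_integral => sig _.
  transitivity (between 0 sig t * (kap%:E * \int[leb]_tau (between sig tau t * P sig tau))).
    congr (_ * _).
    rewrite (_ : Kop g (dyson_step g kap t F sig) = fun y => kap%:E *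
       \int[leb]_tau (between sig tau t * Kop g (Qop kap (tau - sig) (Psi tau)) y)); last first.
      by apply/funext => y; exact: Kop_dyson_step.
    have mB : measurable_fun [set: R * T]
       (fun p => between sig p.1 t * Kop g (Qop kap (p.1 - sig) (Psi p.1)) p.2).
      apply: emeasurable_funM; first exact: measurable_between.
      apply: (@measurable_fun2 _ _ _ _ _ _ _ _
        (fun (q : R * R) (y : T) => Kop g (Qop kap (q.2 - q.1) (Psi q.2)) y)
        (fun p : R * T => (sig, p.1)) snd mKQ) => //.
      exact: measurable_fun_pair.
    rewrite pairingZ ?lee_fin//; last 2 first.
    - by apply: (@measurable_ge0_integral _ _ _ _ _ leb (fun y tau =>
        between sig tau t * Kop g (Qop kap (tau - sig) (Psi tau)) y));
        [exact: (@measurable_fun2 _ _ _ _ _ _ _ _ (fun tau y =>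
        between sig tau t * Kop g (Qop kap (tau - sig) (Psi tau)) y) snd fst)
        |move=> *; rewrite mule_ge0 ?between_ge0].
    - by move=> x; apply: integral_ge0 => tau _; rewrite mule_ge0 ?between_ge0.
    rewrite (@pairing_integral _ _ _ _ leb (fun tau y =>
      between sig tau t * Kop g (Qop kap (tau - sig) (Psi tau)) y))//; last first.
      by move=> tau y; rewrite mule_ge0 ?between_ge0.
    congr (_ * _); apply: eq_integral => tau _.
    have mKQs : measurable_fun setT (Kop g (Qop kap (tau - sig) (Psi tau))).
      apply: measurable_Kop1 => // [|x]; last exact: Qop_ge0.
      apply: measurable_Qop1; exact: measurable_section.
    apply: pairingZ => //; exact: between_ge0.
  have mPs : measurable_fun setT (fun tau => between sig tau t * P sig tau).
    apply: emeasurable_funM; first exact: measurable_between.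
    by apply: (@measurable_fun2 _ _ _ _ _ _ _ _ P).
  have P0s tau : 0 <= between sig tau t * P sig tau by rewrite mule_ge0 ?between_ge0.
  rewrite -ge0_integralZl// -?ge0_integralZl ?between_ge0 ?lee_fin//; last 2 first.
  - exact: measurable_funeM.
  - by move=> tau _; rewrite mule_ge0 ?lee_fin.
  apply: eq_integral => tau _.
  by rewrite between_split muleCA !muleA.
rewrite remE pairing_dyson_step// -ge0_muleDr; last 2 first.
- by apply: integral_ge0 => tau _; rewrite mule_ge0 ?between_ge0//;
    apply: pairing_ge0 => // x; apply: Qop_ge0; exact: Psi0.
- by apply: integral_ge0 => tau _; apply: integral_ge0 => sig _;
    rewrite !mule_ge0 ?between_ge0 ?lee_fin.
have mA : measurable_fun setT
    (fun tau => between 0 tau t * pairing (Qop kap tau (Psi tau)) f_ini).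
  apply: emeasurable_funM; first exact: measurable_between.
  apply: (@measurable_pairing _ _ _ _ (fun tau => Qop kap tau (Psi tau)) (fun=> f_ini)) => //.
  - exact: (@measurable_Qop _ _ _ _ _ id).
  - by move=> *; exact: Qop_ge0.
  - exact: (measurableT_comp mf_ini measurable_snd).
have mB : measurable_fun [set: R * R] (fun q =>
    kap%:E * (between 0 q.1 t * between 0 q.2 q.1 * P q.2 q.1)).
  apply: measurable_funeM; apply: emeasurable_funM.
    by apply: emeasurable_funM; exact: measurable_between.
  by apply: (@measurable_fun2 _ _ _ _ _ _ _ _ P).
have B0 tau sig : 0 <= kap%:E * (between 0 tau t * between 0 sig tau * P sig tau).
  by rewrite !mule_ge0 ?between_ge0 ?lee_fin.
have mB' : measurable_fun setT (fun tau => \int[leb]_sig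
    (kap%:E * (between 0 tau t * between 0 sig tau * P sig tau))).
  exact: (@measurable_ge0_integral _ _ _ _ _ leb (fun tau sig =>
    kap%:E * (between 0 tau t * between 0 sig tau * P sig tau))).
rewrite /remainder lee_wpmul2l ?lee_fin// -ge0_integralD//; last 2 first.
- by move=> tau _; rewrite mule_ge0 ?between_ge0//; apply: pairing_ge0 => // x; apply: Qop_ge0; exact: Psi0.
- by move=> tau _; apply: integral_ge0.
apply: ge0_le_integral => //.
- by move=> tau _; rewrite mule_ge0 ?between_ge0//; apply: pairing_ge0 => // x; exact: Psi0.
- exact: measurable_remainder.
- exact: emeasurable_funD.
move=> tau _.
(* Outside [0, t] the left side is zero; inside, tau >= 0 gives access to [duhamel]. *)
have [/andP[h1 h2]|/negPf h] := boolP ((0 <= tau) && (tau <= t))%R; last first.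
  have -> : between 0 tau t = 0 by rewrite /between h.
  by rewrite !mul0e add0e; apply: integral_ge0 => sig _; rewrite !mul0e mule0.
have -> : between 0 tau t = 1 by rewrite /between h1 h2.
rewrite !mul1e; have := duhamel h1 (measurable_section tau mPsi) (Psi0 tau).
move=> /le_trans; apply; rewrite leeD2l// -ge0_integralZl ?lee_fin//; last 2 first.
- apply: emeasurable_funM; first exact: measurable_between.
  by apply: (@measurable_fun2 _ _ _ _ _ _ _ _ P).
- by move=> sig _; rewrite mule_ge0 ?between_ge0//; exact: P0.
by rewrite le_eqVlt; apply/orP; left; apply/eqP/eq_integral => sig _; rewrite mul1e.
Qed.

Lemma remainderD (F G : R -> T -> \bar R) :
  measurable_fun [set: R * T] (fun p => F p.1 p.2) -> (forall s x, 0 <= F s x) ->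
  measurable_fun [set: R * T] (fun p => G p.1 p.2) -> (forall s x, 0 <= G s x) ->
  remainder (fun s x => F s x + G s x) = remainder F + remainder G.
Proof.
move=> mF F0 mG G0.
have i0 (H : R -> T -> \bar R) tau : (forall s x, 0 <= H s x) ->
    0 <= between 0 tau t * pairing (Kop g (H tau)) (f tau).
  by move=> H0; rewrite mule_ge0 ?between_ge0//; apply: pairing_ge0 => // x; exact: Kop_ge0.
rewrite /remainder -ge0_muleDr; [|by apply: integral_ge0 => tau _; exact: i0..].
rewrite -ge0_integralD//; [|by move=> tau _; exact: i0|exact: measurable_remainder
  |by move=> tau _; exact: i0|exact: measurable_remainder].
congr (_ * _); apply: eq_integral => tau _.
rewrite -ge0_muleDr; [|by apply: pairing_ge0 => // x; exact: Kop_ge0..].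
have mK (H : R -> T -> \bar R) : measurable_fun [set: R * T] (fun p => H p.1 p.2) ->
    (forall s x, 0 <= H s x) -> measurable_fun setT (Kop g (H tau)).
  by move=> mH H0; apply: measurable_Kop1 => //; exact: measurable_section.
have K0 (H : R -> T -> \bar R) x : (forall s x, 0 <= H s x) -> 0 <= Kop g (H tau) x.
  by move=> H0; exact: Kop_ge0.
rewrite -pairingD//; [|exact: mK|exact: mK|by move=> x; exact: K0|by move=> x; exact: K0].
congr (_ * pairing _ _); apply/funext => x.
by rewrite KopD//; exact: measurable_section.
Qed.

Section Iterates.
Variable phi : T -> \bar R.
Hypotheses (mphi : measurable_fun setT phi) (phi0 : forall x, 0 <= phi x).

Definition dyson (n : nat) : R -> T -> \bar R :=
  iter n (dyson_step g kap t) (fun sig => Qop kap (t - sig) phi).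

Lemma dyson_ge0 n sig x : 0 <= dyson n sig x.
Proof.
elim: n sig x => [|n IH] sig x /=; first exact: Qop_ge0.
exact: dyson_step_ge0.
Qed.

Lemma measurable_dyson n : measurable_fun [set: R * T] (fun p => dyson n p.1 p.2).
Proof.
elim: n => [|n IH] /=.
  apply: (@measurable_Qop _ _ _ _ R (fun s => t - s)%R (fun=> phi)).
    exact: measurable_funB.
  exact: (measurableT_comp mphi measurable_snd).
by apply: measurable_dyson_step => // s x; exact: dyson_ge0.
Qed.

Definition dyson_sum (n : nat) (sig : R) (x : T) : \bar R :=
  \sum_(j < n) dyson j sig x.

Lemma dyson_sum_ge0 n sig x : 0 <= dyson_sum n sig x.
Proof. by apply: sume_ge0 => j _; exact: dyson_ge0. Qed.

Lemma measurable_dyson_sum n : measurable_fun [set: R * T] (fun p => dyson_sum n p.1 p.2).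
Proof.
by apply: (emeasurable_sum _ (h := fun (j : 'I_n) p => dyson j p.1 p.2)) => j;
  exact: measurable_dyson.
Qed.

(** Splitting off the first term instead of the last shows the partial sums as Picard iterates, the
    form in which they can be compared with a supersolution. *)
Lemma dyson_sumS n sig x :
  dyson_sum n.+1 sig x = Qop kap (t - sig) phi x + dyson_step g kap t (dyson_sum n) sig x.
Proof.
rewrite /dyson_sum big_ord_recl; congr (_ + _).
rewrite (eq_bigr (fun i : 'I_n => dyson_step g kap t (dyson i) sig x)); last first.
  by move=> i _; rewrite lift0.
elim: n => [|n IH].
  rewrite big_ord0 /dyson_step; under eq_integral do
    (rewrite /Qop /Kop; under eq_integral do rewrite big_ord0 mule0).
  by rewrite integral0_eq ?mule0// => tau _; rewrite integral0 !mule0.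
rewrite big_ord_recr IH.
transitivity (dyson_step g kap t (fun s x => dyson_sum n s x + dyson n s x) sig x).
  symmetry; apply: dyson_stepD.
  - exact: mg.
  - exact: g0.
  - exact: measurable_dyson_sum.
  - by move=> *; exact: dyson_sum_ge0.
  - exact: measurable_dyson.
  - by move=> *; exact: dyson_ge0.
apply: (congr1 (fun F => dyson_step g kap t F sig x)).
by apply/funext => s; apply/funext => y; rewrite big_ord_recr.
Qed.

(** The term [dyson n] occurs twice: it is the last one paired with [f_ini], and the remainder is
    the time integral of K applied to it. *)
Lemma pairing_le_dyson n :
  pairing phi (f t) <= pairing (dyson_sum n.+1 0) f_ini + remainder (dyson n).
Proof.
elim: n => [|n IH].
  have := duhamel t0 mphi phi0.
  rewrite (_ : dyson_sum 1 0 = Qop kap t phi)//.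
  by apply/funext => x; rewrite /dyson_sum big_ord1/= subr0.
apply: (le_trans IH).
have -> : dyson_sum n.+2 0 = fun x => dyson_sum n.+1 0 x + dyson n.+1 0 x.
  by apply/funext => x; rewrite /dyson_sum big_ord_recr.
have -> : pairing (fun x => dyson_sum n.+1 0 x + dyson n.+1 0 x) f_ini =
    pairing (dyson_sum n.+1 0) f_ini + pairing (dyson n.+1 0) f_ini.
  apply: pairingD.
  - by apply: measurable_section; exact: measurable_dyson_sum.
  - by apply: measurable_section; exact: measurable_dyson.
  - exact: mf_ini.
  - exact: f_ini0.
  - by move=> x; exact: dyson_sum_ge0.
  - by move=> x; exact: dyson_ge0.
rewrite -addeA; apply: leeD2l; apply: remainder_step; first exact: measurable_dyson.
by move=> *; exact: dyson_ge0.
Qed.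

(* In the time variable sig, the dual equation runs backwards from the value phi at t. *)
Definition supersolution (G : R -> T -> \bar R) : Prop :=
  forall sig x, (sig <= t)%R ->
    Qop kap (t - sig) phi x + dyson_step g kap t G sig x <= G sig x.

(** Picard iteration is monotone and starts from 0, which lies below [G]; the supersolution
    inequality preserves this order at each step. *)
Lemma dyson_sum_le (G : R -> T -> \bar R) n sig x :
  measurable_fun [set: R * T] (fun p => G p.1 p.2) -> (forall s x, 0 <= G s x) ->
  supersolution G -> (sig <= t)%R -> dyson_sum n sig x <= G sig x.
Proof.
move=> mG G0 sG; elim: n sig x => [|n IH] sig x st; first by rewrite /dyson_sum big_ord0.
rewrite dyson_sumS; apply: le_trans (sG _ _ st); apply: leeD2l.
apply: dyson_step_le.
- exact: mg.
- exact: g0.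
- exact: kap0.
- exact: measurable_dyson_sum.
- by move=> *; exact: dyson_sum_ge0.
- exact: mG.
- exact: G0.
- by move=> s y st'; exact: IH.
Qed.

(** Additivity of [remainder] turns the sum into the remainder of a partial sum, to which the
    comparison with a supersolution applies. *)
Lemma remainder_sum n :
  \sum_(j < n) remainder (dyson j) <= remainder (dyson_sum n).
Proof.
elim: n => [|n IH].
  by rewrite big_ord0; apply: remainder_ge0 => *; exact: dyson_sum_ge0.
rewrite big_ord_recr/= (_ : dyson_sum n.+1 = fun s x => dyson_sum n s x + dyson n s x).
  have -> : remainder (fun s x => dyson_sum n s x + dyson n s x) =
    remainder (dyson_sum n) + remainder (dyson n); last exact: leeD2r.
  apply: remainderD.
  - exact: measurable_dyson_sum.
  - by move=> *; exact: dyson_sum_ge0.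
  - exact: measurable_dyson.
  - by move=> *; exact: dyson_ge0.
by apply/funext => s; apply/funext => x; rewrite /dyson_sum big_ord_recr.
Qed.

(* The remainders add up to at most the finite [remainder G2], hence they can be dropped. *)
Lemma pairing_le_supersolution (G G2 : R -> T -> \bar R) :
  measurable_fun [set: R * T] (fun p => G p.1 p.2) -> (forall s x, 0 <= G s x) ->
  measurable_fun [set: R * T] (fun p => G2 p.1 p.2) -> (forall s x, 0 <= G2 s x) ->
  supersolution G -> supersolution G2 -> remainder G2 < +oo ->
  pairing phi (f t) <= pairing (G 0%R) f_ini.
Proof.
move=> mG G0 mG2 G20 sG sG2 rG2.
have h n : pairing phi (f t) <= pairing (G 0%R) f_ini + remainder (dyson n).
  apply: (le_trans (pairing_le_dyson n)); apply: leeD2r.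
  apply: pairing_le.
  - by apply: measurable_section; exact: measurable_dyson_sum.
  - exact: measurable_section.
  - exact: mf_ini.
  - exact: f_ini0.
  - by move=> x; exact: dyson_sum_ge0.
  - by move=> x; exact: dyson_sum_le.
have rs n : \sum_(j < n) remainder (dyson j) <= remainder G2.
  apply: (le_trans (remainder_sum n)); apply: lee_wpmul2l; first by rewrite lee_fin.
  apply: ge0_le_integral.
  - exact: measurableT.
  - move=> tau _; apply: mule_ge0; first exact: between_ge0.
    apply: pairing_ge0; last exact: f0.
    by move=> x; apply: Kop_ge0; [exact: g0|move=> y; exact: dyson_sum_ge0].
  - by apply: measurable_remainder; [exact: measurable_dyson_sum|move=> *; exact: dyson_sum_ge0].
  - exact: measurable_remainder.
  move=> tau _; have [tt|tt] := leP tau t; last first.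
    by rewrite /between (leNgt tau t) tt andbF !mul0e.
  apply: lee_wpmul2l; first exact: between_ge0.
  have mS : measurable_fun setT (dyson_sum n tau).
    by apply: measurable_section; exact: measurable_dyson_sum.
  have S0 x : 0 <= dyson_sum n tau x by exact: dyson_sum_ge0.
  have SG x : dyson_sum n tau x <= G2 tau x by exact: dyson_sum_le.
  have mG2s : measurable_fun setT (G2 tau) by exact: measurable_section.
  move: (dyson_sum n tau) mS S0 SG => S mS S0 SG.
  apply: pairing_le => //.
  - exact: measurable_Kop1.
  - exact: measurable_Kop1.
  - by move=> x; exact: Kop_ge0.
  - by move=> x; exact: Kop_le.
have r0 n : 0 <= remainder (dyson n) by apply: remainder_ge0 => *; exact: dyson_ge0.
apply: (le_of_summable_excess _ _ r0 rs rG2 h).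
- by apply: pairing_ge0 => // x; exact: G0.
- by apply: pairing_ge0.
Qed.

End Iterates.

End Comparison.

(** * The Lyapunov bound is a supersolution *)

Lemma is_derive_cvg (R : realType) (F : R -> R) (F' x : R) :
  is_derive x (1 : R) F F' -> F y @[y --> x] --> F x.
Proof. by move=> [dF _]; apply: differentiable_continuous; exact/derivable1_diffP. Qed.

Lemma integral_itv_derive (R : realType) (F h : R -> R) (a b : R) : a <= b ->
  (forall x, is_derive x (1 : R) F (h x)) -> continuous h ->
  (\int[lebesgue_measure]_(x in `[a, b]) (h x)%:E)%E = (F b - F a)%:E.
Proof.
move=> ab dF ch.
have cF : continuous F.
  by move=> x; exact: is_derive_cvg (dF x).
move: ab; rewrite le_eqVlt => /predU1P[->|ab].
  by rewrite set_itv1 integral_set1 subrr.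
rewrite (continuous_FTC2 (F := F)) ?EFinB//.
- exact: continuous_subspaceT.
- split; first by move=> x _; have [] := dF x.
    exact/cvg_at_right_filter/cF.
  exact/cvg_at_left_filter/cF.
- by move=> x _; rewrite derive1E; have [] := dF x.
Qed.

Lemma is_derive_expR_affine (R : realType) (a b x : R) :
  is_derive x (1 : R) (fun s => expR (a * s + b)) (a * expR (a * x + b)).
Proof.
have dg : is_derive x (1 : R) (fun s : R => a * s + b) a.
  rewrite (_ : (fun s : R => a * s + b) = (a \*: id + cst b))//.
  by apply: is_derive_eq; rewrite /GRing.scale/= mulr1 addr0.
by rewrite mulrC; exact: (@is_derive1_comp _ expR (fun s => a * s + b)).
Qed.

Section Supersolution.
Local Open Scope ereal_scope.
Context {R : realType} (d : nat).
Notation T := 'rV[R]_d.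
Notation mu := (@row_measure R d).
Notation leb := (@lebesgue_measure R).
Variables (g : T -> R) (kap : R).
Hypotheses (mg : measurable_fun setT g) (g0 : forall x, (0 <= g x)%R) (kap0 : (0 <= kap)%R).
Hypothesis g1 : forall y, Kop g (fun=> 1) y = 1.
(** [DPhi] stands for x . grad Phi, known only through its values along the flow. The data stay
    abstract to cover both V and constants, for which [DPhi] is 0. In [lyapunov] the loss and drift
    terms stand on the right, so the left side is an integral in [0, +oo]. *)
Variables (Phi DPhi : T -> R) (C lam : R).
Hypotheses (C0 : (0 <= C)%R) (lam0 : (0 < lam)%R).
Hypotheses (mPhi : measurable_fun setT Phi) (Phi0 : forall x, (0 <= Phi x)%R).
Hypothesis lyapunov : forall y, kap%:E * Kop g (EFin \o Phi) y <=
  (kap * Phi y + DPhi y + C - lam * Phi y)%:E.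
Hypothesis Phi_derive : forall (x : T) (sig tau : R), is_derive tau (1%R : R)
  (fun tau => Phi (expR (- (tau - sig)) *: x)%R) (- DPhi (expR (- (tau - sig)) *: x))%R.
Hypothesis DPhi_cont : forall (x : T) (sig : R),
  continuous (fun tau : R => DPhi (expR (- (tau - sig)) *: x)%R : R).
Variable t : R.

(* The cut-off at sig = t only serves to make the bound nonnegative for all times. *)
Definition lyapunov_bound (sig : R) (x : T) : \bar R :=
  let r := Num.max (t - sig)%R 0%R in
  (expR (- lam * r) * Phi x + C / lam * (1 - expR (- lam * r)))%:E.

Lemma lyapunov_boundE sig x : (sig <= t)%R -> lyapunov_bound sig x =
  (expR (- lam * (t - sig)) * Phi x + C / lam * (1 - expR (- lam * (t - sig))))%:E.
Proof. by move=> st; rewrite /lyapunov_bound max_l// subr_ge0. Qed.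

Let c0 r : (0 <= r)%R -> (0 <= C / lam * (1 - expR (- lam * r)))%R.
Proof.
move=> r0; rewrite mulr_ge0 ?divr_ge0 ?(ltW lam0)// subr_ge0 -expR0 ler_expR.
by rewrite mulNr oppr_le0 mulr_ge0// ltW.
Qed.

Lemma lyapunov_bound_ge0 sig x : 0 <= lyapunov_bound sig x.
Proof.
rewrite lee_fin; apply: addr_ge0; first by rewrite mulr_ge0 ?expR_ge0.
by apply: c0; rewrite le_max lexx orbT.
Qed.

Lemma measurable_lyapunov_bound :
  measurable_fun [set: R * T] (fun p => lyapunov_bound p.1 p.2).
Proof.
have mr : measurable_fun [set: R * T] (fun p => expR (- lam * Num.max (t - p.1) 0))%R.
  apply: (measurableT_comp (@measurable_expR R)); apply: measurable_funM => //.
  by apply: measurable_maxr => //; exact: measurable_funB.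
apply/measurable_EFinP; apply: measurable_funD.
  by apply: measurable_funM => //; exact: (measurableT_comp mPhi measurable_snd).
by apply: measurable_funM => //; exact: measurable_funB.
Qed.

(** At a fixed time the bound has the form a Phi + b with a, b >= 0: [lyapunov] handles the first
    part, the unit mass of the kernel the second. *)
Let Kop_bound tau y : (tau <= t)%R -> kap%:E * Kop g (lyapunov_bound tau) y <=
  (expR (- lam * (t - tau)) * (kap * Phi y + DPhi y + C - lam * Phi y) +
   kap * (C / lam * (1 - expR (- lam * (t - tau)))))%:E.
Proof.
move=> tt; set a := expR _; set b := (C / lam * _)%R.
have a0 : (0 <= a)%R by exact: expR_ge0.
have b0 : (0 <= b)%R by apply: c0; rewrite subr_ge0.
have -> : lyapunov_bound tau = fun x => a%:E * (EFin \o Phi) x + b%:E * cst 1 x.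
  by apply/funext => x; rewrite lyapunov_boundE//= mule1 -EFinM -EFinD.
have mP : measurable_fun setT (EFin \o Phi) by exact/measurable_EFinP.
rewrite KopD//.
  rewrite KopZ//.
  rewrite KopZ//.
  rewrite [X in _ + _ * X]g1 mule1 ge0_muleDr; last 2 first.
  - by rewrite mule_ge0 ?lee_fin//; apply: Kop_ge0 => // x; rewrite lee_fin.
  - by rewrite lee_fin.
  rewrite EFinD -EFinM leeD2r// muleCA EFinM; apply: lee_wpmul2l => //.
- exact: measurable_funeM.
- by move=> x; rewrite mule_ge0 ?lee_fin.
- by move=> x; rewrite mule_ge0 ?lee_fin.
Qed.

(** [Theta] is the bound followed along the flow from (sig, x), damped by e^(-kap (tau - sig)). The
    majorant [h] of the Dyson integrand obtained from [Kop_bound] is exactly minus its derivative.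
    Hence the Dyson step is at most Theta(sig) - Theta(t), where Theta(sig) is the bound itself and
    Theta(t) = Q Phi dominates Q phi. *)
Lemma lyapunov_supersolution (phi : T -> \bar R) :
  measurable_fun setT phi -> (forall x, 0 <= phi x) ->
  (forall x, phi x <= (Phi x)%:E) -> supersolution g kap t phi lyapunov_bound.
Proof.
move=> mphi phi0 phiPhi sig x st.
pose y tau := (expR (- (tau - sig)) *: x)%R.
pose A tau := expR (- kap * (tau - sig))%R.
pose B tau := expR (- lam * (t - tau))%R.
pose Theta tau := (A tau * (B tau * Phi (y tau) + C / lam * (1 - B tau)))%R.
pose h tau := (A tau * (B tau * (kap * Phi (y tau) + DPhi (y tau) + C - lam * Phi (y tau))
   + kap * (C / lam * (1 - B tau))))%R.
have dA tau : is_derive tau (1%R : R) A (- kap * A tau)%R.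
  have -> : A = fun s => expR (- kap * s + kap * sig).
    by apply/funext => s; rewrite /A; congr expR; ring.
  exact: is_derive_expR_affine.
have dB tau : is_derive tau (1%R : R) B (lam * B tau)%R.
  have -> : B = fun s => expR (lam * s - lam * t).
    by apply/funext => s; rewrite /B; congr expR; ring.
  exact: is_derive_expR_affine.
have dP tau := Phi_derive x sig tau.
have dT tau : is_derive tau (1%R : R) (fun s => - Theta s)%R (h tau).
  have -> : (fun s => - Theta s)%R =
     (- (A * (B * (Phi \o y) + (C / lam) \*: (cst 1 - B))))%R by [].
  have dP' : is_derive tau (1%R : R) (Phi \o y) (- DPhi (y tau))%R by exact: dP.
  apply: is_derive_eq.
  rewrite /h /GRing.scale/=.
  rewrite (_ : (_ + _)%R tau = B tau * Phi (y tau) + C / lam * (1 - B tau))%R//.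
  by field; rewrite gt_eqF.
have ch : continuous h.
  move=> tau; have cA := is_derive_cvg (dA tau).
  have cB := is_derive_cvg (dB tau); have cP := is_derive_cvg (dP tau).
  apply: cvgM => //; apply: cvgD; last first.
    by apply: cvgMr; apply: cvgMr; apply: cvgB => //; exact: cvg_cst.
  apply: cvgM => //; apply: cvgB; last exact: cvgMr.
  apply: cvgD; last exact: cvg_cst.
  by apply: cvgD; [exact: cvgMr|exact: DPhi_cont].
(* No sign of [DPhi] is known; [h] is nonnegative because it dominates a nonnegative integrand. *)
have h0 tau : (tau <= t)%R -> (0 <= h tau)%R.
  move=> tt; rewrite /h mulr_ge0 ?expR_ge0// -lee_fin; apply: le_trans (Kop_bound _ tt).
  by rewrite mule_ge0 ?lee_fin//; apply: Kop_ge0 => // z; exact: lyapunov_bound_ge0.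
have QT : Qop kap (t - sig) phi x <= (Theta t)%:E.
  rewrite /Theta /Qop /B subrr mulr0 expR0 mul1r subrr mulr0 addr0 EFinM.
  by rewrite lee_wpmul2l ?lee_fin ?expR_ge0.
have Tsig : (Theta sig)%:E = lyapunov_bound sig x.
  rewrite lyapunov_boundE// /Theta /A /B /y subrr mulr0 oppr0 expR0 mul1r scale1r.
  by [].
suff : dyson_step g kap t lyapunov_bound sig x <= (Theta sig - Theta t)%:E.
  by move=> /(leeD QT) /le_trans; apply; rewrite -EFinD addrC subrK Tsig.
have -> : (Theta sig - Theta t)%R = (- Theta t - - Theta sig)%R by rewrite opprK addrC.
rewrite -(integral_itv_derive st dT ch) /dyson_step.
have mh : measurable_fun setT (EFin \o h).
  by apply/measurable_EFinP; exact: continuous_measurable_fun.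
have mI : measurable_fun setT (fun tau => between sig tau t *
    Qop kap (tau - sig) (Kop g (lyapunov_bound tau)) x).
  apply: (@measurable_fun2 _ _ _ _ _ _ _ _
    (fun (p : R * T) tau => between p.1 tau t *
       Qop kap (tau - p.1) (Kop g (lyapunov_bound tau)) p.2)
    (fun=> (sig, x)) id) => //.
  apply: measurable_dyson_integrand => //; first exact: measurable_lyapunov_bound.
  exact: lyapunov_bound_ge0.
have I0 tau : 0 <= between sig tau t * Qop kap (tau - sig) (Kop g (lyapunov_bound tau)) x.
  rewrite mule_ge0 ?between_ge0//; apply: Qop_ge0 => z; apply: Kop_ge0 => // w.
  exact: lyapunov_bound_ge0.
rewrite -ge0_integralZl ?lee_fin//.
rewrite [leRHS]integral_mkcond.
apply: ge0_le_integral => //.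
- by move=> tau _; rewrite mule_ge0 ?lee_fin.
- exact: measurable_funeM.
- apply/(measurable_restrictT _ _).1 => //; exact: measurable_funTS.
move=> tau _; rewrite patchE; case: ifPn => [|].
  rewrite inE/= in_itv/= => /andP[h1 h2].
  rewrite /between h1 h2 mul1e /Qop muleCA /h EFinM.
  by apply: lee_wpmul2l; [rewrite lee_fin expR_ge0|exact: Kop_bound].
by rewrite notin_setE/= in_itv/= => /negP/negPf hn; rewrite /between hn mul0e mule0.
Qed.

End Supersolution.

(** * The weight V and its derivative along rays *)

Section Weight.
Context {R : realType}.
Variables (d : nat) (k : R).
Notation T := 'rV[R]_d.

Lemma dotp_ge0 (x : T) : 0 <= dotp x x.
Proof. by apply: sumr_ge0 => i _; rewrite -expr2 sqr_ge0. Qed.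

Lemma dotpZ (c : R) (x : T) : dotp (c *: x) (c *: x) = c ^+ 2 * dotp x x.
Proof. by rewrite /dotp mulr_sumr; apply: eq_bigr => i _; rewrite !mxE; ring. Qed.

(** As 1 + |x|^2 is positive, the square roots and the power merge into one exponential, from which
    measurability and derivatives are read off. *)
Lemma Vk_expE (x : T) : Vk k x = expR (k / 2 * ln (1 + dotp x x)).
Proof.
have h : 0 < 1 + dotp x x by rewrite ltr_wpDr ?dotp_ge0.
have s0 : 0 < Num.sqrt (1 + dotp x x) by rewrite sqrtr_gt0.
rewrite /Vk /jbr /enorm sqr_sqrtr ?dotp_ge0// /powR gt_eqF//; congr expR.
rewrite -[in RHS](sqr_sqrtr (ltW h)) expr2 lnM ?posrE//. by field.
Qed.

Lemma Vk_ge0 (x : T) : 0 <= Vk k x.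
Proof. by rewrite powR_ge0. Qed.

Lemma measurable_dotp : measurable_fun [set: T] (fun x => dotp x x).
Proof.
rewrite (_ : (fun _ => _) = (fun x : T => \sum_(i < d) x ord0 i * x ord0 i))//.
by apply: measurable_sum => i; apply: measurable_funM; exact: measurable_coord.
Qed.

Lemma measurable_Vk : measurable_fun [set: T] (Vk k).
Proof.
rewrite (_ : Vk k = fun x : T => expR (k / 2 * ln (1 + dotp x x))); last first.
  by apply/funext => x; exact: Vk_expE.
apply: (measurableT_comp (@measurable_expR R)); apply: measurable_funM => //.
apply: (measurableT_comp (@measurable_ln R)); apply: measurable_funD => //.
exact: measurable_dotp.
Qed.

(** The flow moves points along rays and x . grad V is a radial derivative, so a function of the
    single variable c carries all the differentiation. *)
Lemma is_derive_Vk_ray (x : T) (c : R) :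
  is_derive c (1 : R) (fun c => Vk k (c *: x))
    (k * c * dotp x x / (1 + c ^+ 2 * dotp x x) * Vk k (c *: x)).
Proof.
have q0 := dotp_ge0 x; set q := dotp x x in q0 *.
have p0 : 0 < 1 + c ^+ 2 * q by rewrite ltr_wpDr// mulr_ge0// sqr_ge0.
rewrite (_ : (fun _ => _) = expR \o (k / 2 \*: (@ln R \o (cst 1 + q \*: (fun c => c ^+ 2))))); last first.
  apply/funext => z /=; rewrite Vk_expE dotpZ -/q. by rewrite [z ^+ 2 * q]mulrC.
have dl : is_derive ((cst 1 + q \*: (fun c : R => c ^+ 2)) c) (1 : R) (@ln R)
    (1 + c ^+ 2 * q)^-1.
  rewrite (_ : (cst 1 + q \*: (fun c : R => c ^+ 2)) c = 1 + c ^+ 2 * q); last first.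
    by rewrite [c ^+ 2 * q]mulrC.
  exact: is_derive1_ln.
apply: is_derive_eq.
rewrite Vk_expE dotpZ -/q /=.
rewrite (_ : ln _ = ln (1 + c ^+ 2 * q)); last by rewrite [c ^+ 2 * q]mulrC.
rewrite /GRing.scale/=; field; rewrite gt_eqF//.
Qed.

(** Since x + h x = (1 + h) x, the difference quotients in direction x are those of the ray at c =
    1. *)
Lemma derive_Vk_self (x : T) :
  'D_x (Vk k) x = k * dotp x x / (1 + dotp x x) * Vk k x.
Proof.
have [_] := is_derive_Vk_ray x 1.
rewrite scale1r expr1n mul1r mulr1 => <-.
rewrite /derive; apply: (congr1 (fun F : R -> R => lim (F @ 0^'))).
apply/funext => h.
by rewrite /= scale1r /shift/= [h *: 1]mulr1 scalerDl scale1r.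
Qed.

(** Chain rule with c = e^(-(tau - sig)), whose derivative is -c: the remaining factor c completes
    the radial derivative at c x, and the sign comes from the contracting flow. *)
Lemma is_derive_Vk_flow (x : T) (sig tau : R) :
  is_derive tau (1 : R) (fun tau => Vk k (expR (- (tau - sig)) *: x))
    (- 'D_(expR (- (tau - sig)) *: x) (Vk k) (expR (- (tau - sig)) *: x)).
Proof.
have dE : is_derive tau (1 : R) (fun tau => expR (- (tau - sig))) (- expR (- (tau - sig))).
  have := is_derive_expR_affine (-1) sig tau.
  rewrite (_ : (fun s => _) = fun tau => expR (- (tau - sig))); last first.
    by apply/funext => z; congr expR; ring.
  by rewrite mulN1r (_ : -1 * tau + sig = - (tau - sig))//; ring.
have h := @is_derive1_comp _ (fun c => Vk k (c *: x)) (fun tau => expR (- (tau - sig)))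
  tau _ _ (is_derive_Vk_ray x _) dE.
rewrite derive_Vk_self dotpZ.
move: h; set c := expR _; move=> h.
have -> : - (k * (c ^+ 2 * dotp x x) / (1 + c ^+ 2 * dotp x x) * Vk k (c *: x)) =
   k * c * dotp x x / (1 + c ^+ 2 * dotp x x) * Vk k (c *: x) * - c by ring.
exact: h.
Qed.

Lemma continuous_derive_Vk_flow (x : T) (sig : R) :
  continuous (fun tau : R =>
    'D_(expR (- (tau - sig)) *: x) (Vk k) (expR (- (tau - sig)) *: x) : R).
Proof.
move=> tau.
rewrite (_ : (fun tau : R => _) = fun tau =>
  k * (expR (- (tau - sig)) ^+ 2 * dotp x x) / (1 + expR (- (tau - sig)) ^+ 2 * dotp x x)
  * Vk k (expR (- (tau - sig)) *: x)); last first.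
  by apply/funext => s; rewrite derive_Vk_self dotpZ.
have cV : Vk k (expR (- (s - sig)) *: x) @[s --> tau] --> Vk k (expR (- (tau - sig)) *: x).
  exact: is_derive_cvg (is_derive_Vk_flow x sig tau).
have cE : expR (- (s - sig)) @[s --> tau] --> expR (- (tau - sig)).
  apply: continuous_comp; last exact: continuous_expR.
  by apply: cvgN; apply: cvgB => //; exact: cvg_cst.
have cq : expR (- (s - sig)) ^+ 2 * dotp x x @[s --> tau] -->
    expR (- (tau - sig)) ^+ 2 * dotp x x.
  by apply: cvgM; [rewrite expr2; apply: cvgM|exact: cvg_cst].
apply: cvgM => //; apply: cvgM; first by apply: cvgM => //; exact: cvg_cst.
apply: cvgV; last by apply: cvgD => //; exact: cvg_cst.
by rewrite gt_eqF// ltr_wpDr// mulr_ge0 ?sqr_ge0 ?dotp_ge0.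
Qed.

End Weight.

(** * Integrals on R^d and the operator K for a probability kernel *)

Section Kernel.
Local Open Scope ereal_scope.
Context {R : realType} (d : nat).
Notation T := 'rV[R]_d.
Notation mu := (@row_measure R d).
Notation leb := (@lebesgue_measure R).

Lemma IintE (h : T -> R) : measurable_fun setT h ->
  Iint h = \int[mu]_x (h x)%:E.
Proof.
move=> mh; rewrite [RHS]integralE /Iint !iintE; last 4 first.
- by apply/measurable_EFinP; apply: measurable_maxr => //; exact: measurable_funN.
- by move=> x; rewrite lee_fin le_max lexx orbT.
- by apply/measurable_EFinP; exact: measurable_maxr.
- by move=> x; rewrite lee_fin le_max lexx orbT.
by congr (_ - _); apply: eq_integral => x _; rewrite ?funeposE ?funenegE ?EFin_max ?EFinN.
Qed.

Lemma L1normE (h : T -> R) : measurable_fun setT h ->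
  L1norm h = \int[mu]_x `|h x|%:E.
Proof.
move=> mh; rewrite /L1norm iintE//.
by apply/measurable_EFinP; exact: measurableT_comp.
Qed.

Lemma normVE k (h : T -> R) : measurable_fun setT h ->
  normV k h = pairing (EFin \o Vk k) (fun x => `|h x|%R).
Proof.
move=> mh; rewrite /normV /pairing iintE//.
- apply/measurable_EFinP; apply: measurable_funM; first exact: measurable_Vk.
  exact: measurableT_comp.
- by move=> x; rewrite lee_fin mulr_ge0// Vk_ge0.
Qed.

Lemma ae_Rd_ae (P : T -> Prop) : ae_Rd P -> {ae mu, forall x, P x}.
Proof.
move=> [N [/borel_Rd_measurable mN [N0 NP]]]; exists N; split => //.
  rewrite -[N]setIT -integral_indic// -iintE//.
  by apply/measurable_EFinP; exact: measurable_indic.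
by move=> x /= nPx; apply: contrapT => /NP.
Qed.

Lemma ge0_integral_rowD (b : T) (f : T -> \bar R) :
  measurable_fun setT f -> (forall x, 0 <= f x) ->
  \int[mu]_x f (x + b)%R = \int[mu]_x f x.
Proof.
move=> mf f0; have := ge0_integral_row_affine b ltr01 mf f0.
rewrite expr1n invr1 mul1e => <-.
by apply: eq_integral => x _; rewrite scale1r.
Qed.

Lemma ge0_integral_rowZ (a : R) (f : T -> \bar R) : (0 < a)%R ->
  measurable_fun setT f -> (forall x, 0 <= f x) ->
  \int[mu]_x f (a *: x)%R = (a ^- d)%:E * \int[mu]_x f x.
Proof.
move=> a0 mf f0; have := ge0_integral_row_affine 0%R a0 mf f0.
by move=> <-; apply: eq_integral => x _; rewrite addr0.
Qed.

Section Translation.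
Variables (g : T -> R).
Hypotheses (mg : measurable_fun setT g) (g0 : forall x, (0 <= g x)%R).

Lemma Kop_translate (psi : T -> \bar R) y : measurable_fun setT psi ->
  (forall x, 0 <= psi x) ->
  Kop g psi y = \int[mu]_z ((g z)%:E * psi (y + z)%R).
Proof.
move=> mp p0; rewrite /Kop.
rewrite -(@ge0_integral_rowD y (fun z => (g (z - y))%:E * psi z)).
- by apply: eq_integral => z _; rewrite addrK [(z + y)%R]addrC.
- apply: emeasurable_funM => //; apply/measurable_EFinP.
  by apply: (measurableT_comp mg); exact: measurable_rowB.
- by move=> x; rewrite mule_ge0// lee_fin.
Qed.

Hypothesis g1 : \int[mu]_x (g x)%:E = 1.

Lemma Kop_cst1 y : Kop g (fun=> 1) y = 1.
Proof.
rewrite Kop_translate// -[RHS]g1.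
by apply: eq_integral => z _; rewrite mule1.
Qed.

(** The negative part of the increment integrand is at most g(z) phi(y), so its integral is at most
    phi(y). Thus [Iint] is a genuine difference even when its positive part is infinite. *)
Lemma Kop_increment (phi : T -> R) y : measurable_fun setT phi ->
  (forall x, (0 <= phi x)%R) ->
  Kop g (EFin \o phi) y = Iint (fun z => g z * (phi (y + z) - phi y))%R + (phi y)%:E.
Proof.
move=> mphi phi0.
have mpy : measurable_fun setT (fun z : T => phi (y + z)%R).
  have -> : (fun z : T => phi (y + z)%R) = (fun z : T => phi (z - - y)%R).
    by apply/funext => z; rewrite opprK addrC.
  by apply: (measurableT_comp mphi); exact: measurable_rowB.
set h := fun z : T => (g z * (phi (y + z) - phi y))%R.
have mh : measurable_fun setT h.
  by apply: measurable_funM => //; exact: measurable_funB.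
rewrite IintE// integralE.
have mP : measurable_fun setT (EFin \o h)^\+ by apply: measurable_funepos; exact/measurable_EFinP.
have mN : measurable_fun setT (EFin \o h)^\- by apply: measurable_funeneg; exact/measurable_EFinP.
have gphi : \int[mu]_z ((g z)%:E * (phi y)%:E) = (phi y)%:E.
  rewrite ge0_integralZr//.
  - by rewrite g1 mul1e.
  - exact/measurable_EFinP.
  - by move=> z _; rewrite lee_fin.
  - by rewrite lee_fin.
have mgphi : measurable_fun setT (fun z => (g z)%:E * (phi y)%:E).
  by apply: emeasurable_funM => //; exact/measurable_EFinP.
(* Rearranged so that both sides are sums of nonnegative integrals, which may be added without
   integrability. *)
have key : Kop g (EFin \o phi) y + \int[mu]_z (EFin \o h)^\- z =
    \int[mu]_z (EFin \o h)^\+ z + (phi y)%:E.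
  rewrite Kop_translate//; last exact/measurable_EFinP.
  rewrite -gphi -ge0_integralD//; last 2 first.
  - by move=> z _; rewrite mule_ge0 ?lee_fin.
  - apply: emeasurable_funM; first exact/measurable_EFinP.
    by apply/measurable_EFinP; exact: mpy.
  rewrite -ge0_integralD//; last first.
  - by move=> z _; rewrite mule_ge0 ?lee_fin.
  apply: eq_integral => z _; rewrite funeposE funenegE /= -!EFin_max -!EFinM -!EFinD.
  congr EFin; rewrite /h; case: (leP (phi (y + z)%R) (phi y)) => h1.
    have h2 : (g z * (phi (y + z) - phi y) <= 0)%R.
      by rewrite mulr_ge0_le0// subr_le0.
    by rewrite max_l ?oppr_ge0// max_r//; ring.
  have h2 : (0 <= g z * (phi (y + z) - phi y))%R.
    by rewrite mulr_ge0// subr_ge0 ltW.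
  by rewrite max_r ?oppr_le0// max_l//; ring.
have Nle : \int[mu]_z (EFin \o h)^\- z <= (phi y)%:E.
  rewrite -[leRHS]gphi; apply: ge0_le_integral => //.
  move=> z _; rewrite funenegE /= -EFin_max -EFinM lee_fin ge_max.
  rewrite mulr_ge0// andbT /h -mulrN; apply: ler_wpM2l => //.
  by rewrite opprB lerBlDr lerDl.
have Nfin : \int[mu]_z (EFin \o h)^\- z \is a fin_num.
  rewrite ge0_fin_numE; first exact: (le_lt_trans Nle (ltry _)).
  exact: integral_ge0.
by rewrite addeAC -key addeK.
Qed.

End Translation.
End Kernel.

(** * The Duhamel inequality for a mild solution *)

Section Duhamel.
Local Open Scope ereal_scope.
Context {R : realType} (d : nat).
Notation T := 'rV[R]_d.
Notation mu := (@row_measure R d).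
Notation leb := (@lebesgue_measure R).

(** Q_r is the dual of T_r: the substitution z = e^r x produces e^(-d r), which turns e^((d - kap)
    r) into e^(-kap r). *)
Lemma integral_dilation (kap r : R) (psi W : T -> \bar R) :
  measurable_fun setT psi -> (forall x, 0 <= psi x) ->
  measurable_fun setT W -> (forall x, 0 <= W x) ->
  \int[mu]_x (psi x * ((expR ((d%:R - kap) * r))%:E * W (expR r *: x)%R)) =
  \int[mu]_z (Qop kap r psi z * W z).
Proof.
move=> mp p0 mW W0.
have mpr : measurable_fun setT (fun z : T => psi (expR (- r) *: z)%R).
  by apply: (measurableT_comp mp); exact: measurable_rowZ.
pose F (z : T) := psi (expR (- r) *: z)%R * W z.
have mF : measurable_fun setT F by exact: emeasurable_funM.
have F0 z : 0 <= F z by rewrite mule_ge0.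
have mFr : measurable_fun setT (fun z : T => F (expR r *: z)%R).
  by apply: (measurableT_comp mF); exact: measurable_rowZ.
transitivity (\int[mu]_x ((expR ((d%:R - kap) * r))%:E * F (expR r *: x)%R)).
  apply: eq_integral => x _; rewrite /F scalerA -expRD addNr expR0 scale1r.
  by rewrite muleCA.
rewrite ge0_integralZl ?lee_fin ?expR_ge0//.
rewrite ge0_integral_rowZ ?expR_gt0// muleA -EFinM.
transitivity (\int[mu]_z ((expR (- kap * r))%:E * F z)); last first.
  by apply: eq_integral => z _; rewrite /F /Qop muleA.
rewrite ge0_integralZl ?lee_fin ?expR_ge0//; congr (_%:E * _).
by rewrite -expRM_natl -expRN -expRD; congr expR; ring.
Qed.

Variables (g : T -> R) (s eps : R).
Hypotheses (mg : measurable_fun setT g) (g0 : forall x, (0 <= g x)%R).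
Notation kap := (eps `^ (- (2 * s)))%R.
Variables (u0 : T -> R) (u : R -> T -> R).
Hypotheses (mu0 : measurable_fun setT u0)
  (mu_ : measurable_fun [set: R * T] (fun p => u p.1 p.2)).

Let absconv (sig : R) (z : T) := \int[mu]_y (g (z - y) * `|u sig y|)%:E.

Let absconv_ge0 sig z : 0 <= absconv sig z.
Proof. by apply: integral_ge0 => y _; rewrite lee_fin mulr_ge0. Qed.

Let mgu : measurable_fun [set: (R * T) * T] (fun q => g (q.1.2 - q.2) * u q.1.1 q.2)%R.
Proof.
apply: measurable_funM.
  apply: (measurableT_comp mg); apply: measurable_rowB => //.
  exact: (measurableT_comp measurable_snd measurable_fst).
apply: (@measurable_fun2 _ _ _ _ _ _ _ _ u) => //.
exact: (measurableT_comp measurable_fst measurable_fst).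
Qed.

Let mgua : measurable_fun [set: (R * T) * T] (fun q => g (q.1.2 - q.2) * `|u q.1.1 q.2|)%R.
Proof.
rewrite (_ : (fun _ => _) = fun q : (R * T) * T => `|g (q.1.2 - q.2) * u q.1.1 q.2|)%R.
  exact: measurableT_comp.
by apply/funext => q; rewrite normrM ger0_norm.
Qed.

Let measurable_absconv : measurable_fun [set: R * T] (fun p => absconv p.1 p.2).
Proof.
apply: (@measurable_ge0_integral _ _ _ _ _ mu
  (fun (p : R * T) y => (g (p.2 - y) * `|u p.1 y|)%:E)).
  exact/measurable_EFinP.
by move=> p y; rewrite lee_fin mulr_ge0.
Qed.

Let mgus sig (z : T) : measurable_fun setT (fun y : T => g (z - y) * u sig y)%R.
Proof.
by apply: (@measurable_fun2 _ _ _ _ _ _ _ _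
  (fun (p : R * T) (y : T) => g (p.2 - y) * u p.1 y)%R (fun=> (sig, z)) id).
Qed.

Lemma measurable_conv : measurable_fun [set: R * T] (fun p => Defs.conv g (u p.1) p.2).
Proof.
apply: (measurableT_comp (fine_measurable measurableT)) => //.
rewrite (_ : (fun _ => _) = fun p : R * T =>
  \int[mu]_y (Num.max (g (p.2 - y) * u p.1 y) 0)%R%:E -
  \int[mu]_y (Num.max (- (g (p.2 - y) * u p.1 y)) 0)%R%:E).
  apply: emeasurable_funB.
    apply: (@measurable_ge0_integral _ _ _ _ _ mu
      (fun (p : R * T) y => (Num.max (g (p.2 - y) * u p.1 y) 0)%R%:E)).
      by apply/measurable_EFinP; exact: measurable_maxr.
    by move=> p y; rewrite lee_fin le_max lexx orbT.
  apply: (@measurable_ge0_integral _ _ _ _ _ mu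
    (fun (p : R * T) y => (Num.max (- (g (p.2 - y) * u p.1 y)) 0)%R%:E)).
    by apply/measurable_EFinP; apply: measurable_maxr => //; exact: measurable_funN.
  by move=> p y; rewrite lee_fin le_max lexx orbT.
apply/funext => p; rewrite /Iint !iintE//.
- by apply/measurable_EFinP; apply: measurable_maxr => //; apply: measurable_funN; exact: mgus.
- by move=> x; rewrite lee_fin le_max lexx orbT.
- by apply/measurable_EFinP; apply: measurable_maxr => //; exact: mgus.
- by move=> x; rewrite lee_fin le_max lexx orbT.
Qed.

(** [conv] applies [fine], which sends infinite values to 0 and so does not increase the absolute
    value: the bound also holds where the convolution diverges. *)
Let conv_le sig z : `|Defs.conv g (u sig) z|%:E <= absconv sig z.
Proof.
have fine_le (x : \bar R) : `|fine x|%:E <= `|x| by case: x => [r| |]; rewrite /= ?normr0 ?leey.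
apply: (le_trans (fine_le _)); rewrite IintE; last exact: mgus.
apply: le_trans.
  by apply: le_abse_integral => //; apply/measurable_EFinP; exact: mgus.
by rewrite le_eqVlt; apply/orP; left; apply/eqP/eq_integral => y _;
  rewrite abse_EFin normrM ger0_norm.
Qed.

Lemma mild_pointwise (tau : R) (x : T) : (0 <= tau)%R ->
  (u tau x)%:E = (Tt s eps tau u0 x)%:E + kap%:E *
    \int[leb]_(sig in [set sig : R | (0 <= sig <= tau)%R])
      (Tt s eps (tau - sig) (Defs.conv g (u sig)) x)%:E ->
  `|u tau x|%:E <= (expR ((d%:R - kap) * tau))%:E * `|u0 (expR tau *: x)|%:E +
    kap%:E * \int[leb]_sig (between 0 sig tau *
      ((expR ((d%:R - kap) * (tau - sig)))%:E * absconv sig (expR (tau - sig) *: x))).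
Proof.
move=> tau0 eq; rewrite -abse_EFin eq.
apply: (le_trans (lee_abs_add _ _)); apply: leeD.
  by rewrite abse_EFin /Tt normrM ger0_norm ?expR_ge0// EFinM.
rewrite abseM gee0_abs ?lee_fin ?powR_ge0//; apply: lee_wpmul2l.
  by rewrite lee_fin powR_ge0.
have setE : [set sig : R | (0 <= sig <= tau)%R] = `[0%R, tau]%classic.
  by apply/seteqP; split => z /=; rewrite in_itv.
rewrite setE.
have mr : measurable_fun [set: R] (fun sig => expR (tau - sig) *: x)%R.
  apply: measurable_rowZ => //; apply: (measurableT_comp (@measurable_expR R)).
  exact: measurable_funB.
have mE : measurable_fun [set: R] (fun sig => expR ((d%:R - kap) * (tau - sig)))%R.
  apply: (measurableT_comp (@measurable_expR R)); apply: measurable_funM => //.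
  exact: measurable_funB.
have mT : measurable_fun [set: R] (fun sig => (Tt s eps (tau - sig) (Defs.conv g (u sig)) x)%:E).
  apply/measurable_EFinP; apply: measurable_funM => //.
  by apply: (@measurable_fun2 _ _ _ _ _ _ _ _ (fun sig => Defs.conv g (u sig))) => //;
    exact: measurable_conv.
apply: le_trans.
  by apply: le_abse_integral => //; exact: measurable_funTS.
rewrite integral_mkcond; apply: ge0_le_integral => //.
- by move=> sig _; apply: erestrict_ge0.
- apply/(measurable_restrictT _ _).1 => //; apply: measurable_funTS.
  exact: measurableT_comp.
- apply: emeasurable_funM; first exact: measurable_between.
  apply: emeasurable_funM; first exact/measurable_EFinP.
  exact: (@measurable_fun2 _ _ _ _ _ _ _ _ absconv).
move=> sig _; rewrite patchE; case: ifPn => [|_]; last first.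
  by rewrite !mule_ge0 ?between_ge0 ?lee_fin ?expR_ge0.
rewrite inE/= in_itv/= => /andP[h1 h2]; rewrite /between h1 h2 mul1e.
rewrite /Tt normrM EFinM ger0_norm ?expR_ge0//; apply: lee_wpmul2l; last exact: conv_le.
by rewrite lee_fin expR_ge0.
Qed.

(** The pointwise bound is multiplied by psi and integrated, and all operators are moved onto psi by
    Tonelli: dilations become Q, and convolution with g becomes K, whose kernel g(z - y) is
    integrated in z. *)
Lemma mild_duhamel (tau : R) (psi : T -> \bar R) : (0 <= tau)%R ->
  {ae mu, forall x, (u tau x)%:E = (Tt s eps tau u0 x)%:E + kap%:E *
    \int[leb]_(sig in [set sig : R | (0 <= sig <= tau)%R])
      (Tt s eps (tau - sig) (Defs.conv g (u sig)) x)%:E} ->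
  measurable_fun setT psi -> (forall x, 0 <= psi x) ->
  pairing psi (fun x => `|u tau x|%R) <=
  pairing (Qop kap tau psi) (fun x => `|u0 x|%R) +
    kap%:E * \int[leb]_sig (between 0 sig tau *
       pairing (Kop g (Qop kap (tau - sig) psi)) (fun x => `|u sig x|%R)).
Proof.
move=> tau0 eq mp p0.
have mua : measurable_fun [set: R * T] (fun p => `|u p.1 p.2|%R) by exact: measurableT_comp.
have mus sig : measurable_fun setT (fun x => `|u sig x|%R).
  by apply: (@measurable_fun2 _ _ _ _ _ _ _ _ (fun sig x => `|u sig x|%R)).
have mu0a : measurable_fun setT (fun x => `|u0 x|%:E).
  by apply/measurable_EFinP; exact: measurableT_comp.
have Q0 r x : 0 <= Qop kap r psi x by exact: Qop_ge0.
have mQ r : measurable_fun setT (Qop kap r psi) by exact: measurable_Qop1.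
pose A x := (expR ((d%:R - kap) * tau))%:E * `|u0 (expR tau *: x)%R|%:E.
pose B sig x := (expR ((d%:R - kap) * (tau - sig)))%:E * absconv sig (expR (tau - sig) *: x)%R.
have mA : measurable_fun setT A.
  apply: measurable_funeM.
  apply: (@measurableT_comp _ _ _ _ _ _ (fun x => `|u0 x|%:E)) => //.
  exact: measurable_rowZ.
have A0 x : 0 <= A x by rewrite mule_ge0 ?lee_fin ?expR_ge0.
have mB : measurable_fun [set: R * T] (fun p => B p.1 p.2).
  apply: emeasurable_funM.
    apply/measurable_EFinP; apply: (measurableT_comp (@measurable_expR R)).
    by apply: measurable_funM => //; exact: measurable_funB.
  apply: (@measurable_fun2 _ _ _ _ _ _ _ _ absconv) => //.
  apply: measurable_rowZ => //; apply: (measurableT_comp (@measurable_expR R)).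
  exact: measurable_funB.
have B0 sig x : 0 <= B sig x by rewrite mule_ge0 ?lee_fin ?expR_ge0.
have mbB : measurable_fun [set: T * R] (fun p => between 0 p.2 tau * B p.2 p.1).
  apply: emeasurable_funM; first exact: measurable_between.
  exact: (@measurable_fun2 _ _ _ _ _ _ _ _ B).
have bB0 x sig : 0 <= between 0 sig tau * B sig x by rewrite mule_ge0 ?between_ge0.
have mI : measurable_fun setT (fun x => \int[leb]_sig (between 0 sig tau * B sig x)).
  exact: (@measurable_ge0_integral _ _ _ _ _ leb (fun x sig => between 0 sig tau * B sig x)).
have I0 x : 0 <= \int[leb]_sig (between 0 sig tau * B sig x) by exact: integral_ge0.
have kap0 : 0 <= kap%:E by rewrite lee_fin powR_ge0.
have step : pairing psi (fun x => `|u tau x|%R) <=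
    \int[mu]_x (psi x * A x + kap%:E * (psi x * \int[leb]_sig (between 0 sig tau * B sig x))).
  (* For fixed tau the equation holds off a null set of x, which suffices under the integral. *)
  apply: ae_ge0_le_integral => //.
  - by move=> x _; rewrite mule_ge0 ?lee_fin.
  - by apply: emeasurable_funM => //; exact/measurable_EFinP.
  - by move=> x _; rewrite adde_ge0 ?mule_ge0.
  - apply: emeasurable_funD; first exact: emeasurable_funM.
    by apply: measurable_funeM; exact: emeasurable_funM.
  apply: filterS eq => x eqx _.
  rewrite [kap%:E * (psi x * _)]muleCA -ge0_muleDr ?mule_ge0//; apply: lee_wpmul2l => //.
  exact: mild_pointwise.
apply: (le_trans step).
rewrite ge0_integralD//; last 4 first.
- by move=> x _; rewrite mule_ge0.
- exact: emeasurable_funM.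
- by move=> x _; rewrite !mule_ge0.
- by apply: measurable_funeM; exact: emeasurable_funM.
have -> : \int[mu]_x (psi x * A x) = pairing (Qop kap tau psi) (fun x => `|u0 x|%R).
  exact: (@integral_dilation kap tau psi (fun x => `|u0 x|%:E)).
apply: leeD2l; rewrite ge0_integralZl//; last 2 first.
- exact: emeasurable_funM.
- by move=> x _; rewrite mule_ge0.
apply: lee_wpmul2l => //.
have -> : \int[mu]_x (psi x * \int[leb]_sig (between 0 sig tau * B sig x)) =
    \int[mu]_x \int[leb]_sig (psi x * (between 0 sig tau * B sig x)).
  apply: eq_integral => x _; rewrite ge0_integralZl//.
  exact: (@measurable_fun2 _ _ _ _ _ _ _ _ (fun x sig => between 0 sig tau * B sig x)).
rewrite (@ge0_integral_swap _ _ _ _ _ mu leb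
  (fun x sig => psi x * (between 0 sig tau * B sig x))); last 2 first.
- apply: emeasurable_funM => //; exact: (measurableT_comp mp measurable_fst).
- by move=> x sig; rewrite mule_ge0.
rewrite le_eqVlt; apply/orP; left; apply/eqP/eq_integral => sig _.
have mBs : measurable_fun setT (B sig) by exact: (@measurable_fun2 _ _ _ _ _ _ _ _ B).
have macs : measurable_fun setT (absconv sig).
  exact: (@measurable_fun2 _ _ _ _ _ _ _ _ absconv).
transitivity (between 0 sig tau * \int[mu]_x (psi x * B sig x)).
  rewrite -ge0_integralZl ?between_ge0//.
  - by apply: eq_integral => x _; rewrite muleCA.
  - exact: emeasurable_funM.
  - by move=> x _; rewrite mule_ge0.
congr (_ * _); rewrite integral_dilation//.
transitivity (\int[mu]_z \int[mu]_y
    ((g (z - y))%:E * Qop kap (tau - sig) psi z * `|u sig y|%:E)).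
  apply: eq_integral => z _; rewrite -ge0_integralZl//.
  - by apply: eq_integral => y _; rewrite EFinM muleA [_ * (g _)%:E]muleC.
  - apply/measurable_EFinP; apply: measurable_funM => //.
    by apply: (measurableT_comp mg); exact: measurable_rowB.
  - by move=> y _; rewrite lee_fin mulr_ge0.
rewrite (@ge0_integral_swap _ _ _ _ _ mu mu
  (fun z y => (g (z - y))%:E * Qop kap (tau - sig) psi z * `|u sig y|%:E)); last 2 first.
- apply: emeasurable_funM.
    apply: emeasurable_funM; last exact: (measurableT_comp (mQ _) measurable_fst).
    by apply/measurable_EFinP; apply: (measurableT_comp mg); exact: measurable_rowB.
  by apply/measurable_EFinP; exact: (measurableT_comp (mus sig) measurable_snd).
- by move=> z y; rewrite !mule_ge0 ?lee_fin.
apply: eq_integral => y _; rewrite ge0_integralZr ?lee_fin//.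
- apply: emeasurable_funM => //.
  by apply/measurable_EFinP; apply: (measurableT_comp mg); exact: measurable_rowB.
- by move=> z _; rewrite mule_ge0 ?lee_fin.
Qed.

End Duhamel.

(** * The rescaled kernel and the Lyapunov inequality in terms of K *)

Section Rescaled.
Local Open Scope ereal_scope.
Context {R : realType} (d : nat).
Notation T := 'rV[R]_d.
Notation mu := (@row_measure R d).
Notation leb := (@lebesgue_measure R).
Variables (J : R -> T -> R) (s eps : R).
Hypotheses (mJ : measurable_fun setT (J s)) (J0 : forall x, (0 <= J s x)%R)
  (J1 : Iint (J s) = 1) (eps0 : (0 < eps)%R).

Lemma measurable_Jeps : measurable_fun setT (Jeps J s eps).
Proof.
by apply: measurable_funM => //; apply: (measurableT_comp mJ); exact: measurable_rowZ.
Qed.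

Lemma Jeps_ge0 x : (0 <= Jeps J s eps x)%R.
Proof. by rewrite mulr_ge0// invr_ge0 exprn_ge0// ltW. Qed.

Lemma integral_Jeps : \int[mu]_x (Jeps J s eps x)%:E = 1.
Proof.
have mJE : measurable_fun setT (EFin \o J s) by exact/measurable_EFinP.
have e0 : (0 <= eps ^- d)%R by rewrite invr_ge0 exprn_ge0// ltW.
transitivity (\int[mu]_x ((eps ^- d)%:E * (EFin \o J s) (eps^-1 *: x)%R)).
  by apply: eq_integral => x _; rewrite /Jeps EFinM.
rewrite ge0_integralZl//; last 2 first.
- by apply: (measurableT_comp mJE); exact: measurable_rowZ.
- by move=> x _; rewrite lee_fin.
rewrite ge0_integral_rowZ ?invr_gt0//.
rewrite (_ : \int[mu]_x (EFin \o J s) x = 1); last by rewrite -IintE.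
rewrite mule1 -EFinM; congr EFin.
by rewrite exprVn invrK mulVf// expf_neq0// gt_eqF.
Qed.

(** The jump part of L* is kap (K phi - phi), and phi(y) and the drift are finite. They can
    therefore be moved across the inequality although the jump integral is an extended real. *)
Lemma Lstar_lyapunov (phi : T -> R) (C lam : R) y : measurable_fun setT phi ->
  (forall x, (0 <= phi x)%R) ->
  Lstar J s eps phi y <= (C - lam * phi y)%:E ->
  (eps `^ (- (2 * s)))%:E * Kop (Jeps J s eps) (EFin \o phi) y <=
  (eps `^ (- (2 * s)) * phi y + 'D_y phi y + C - lam * phi y)%:E.
Proof.
move=> mphi phi0; rewrite /Lstar.
rewrite (Kop_increment measurable_Jeps Jeps_ge0 integral_Jeps y mphi phi0).
set kap := (eps `^ _)%R; set I := Iint _ => h.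
rewrite muleDr//; last by rewrite fin_num_adde_defl.
move: h; rewrite leeBlDr// => h.
rewrite (_ : (kap * phi y + 'D_y phi y + C - lam * phi y)%R =
  (C - lam * phi y + 'D_y phi y) + kap * phi y)%R; last by ring.
by rewrite EFinD -EFinM leeD2r// EFinD.
Qed.

End Rescaled.

(** * Truncated weights and bounded time integrals *)

Section TruncatedWeight.
Local Open Scope ereal_scope.
Context {R : realType} (d : nat) (k : R).
Notation T := 'rV[R]_d.

Definition Vtrunc (n : nat) (x : T) : \bar R := (Num.min (Vk k x) n%:R)%:E.

Lemma Vtrunc_ge0 n x : 0 <= Vtrunc n x.
Proof. by rewrite lee_fin le_min Vk_ge0 ler0n. Qed.

Lemma measurable_Vtrunc n : measurable_fun setT (Vtrunc n).
Proof.
by apply/measurable_EFinP; apply: measurable_minr => //; exact: measurable_Vk.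
Qed.

Lemma pairing_Vk_le (h : T -> R) (b : \bar R) : measurable_fun setT h ->
  (forall x, (0 <= h x)%R) -> (forall n, pairing (Vtrunc n) h <= b) ->
  pairing (EFin \o Vk k) h <= b.
Proof.
move=> mh h0 hb.
have mhE : measurable_fun setT (EFin \o h) by exact/measurable_EFinP.
have cv x : Vtrunc n x * (h x)%:E @[n --> \oo] --> (EFin \o Vk k) x * (h x)%:E.
  (* At a given x the truncation is inactive as soon as n exceeds V(x). *)
  apply: cvg_near_cst; exists (Num.truncn (Vk k x)).+1 => // n /= hn.
  rewrite /Vtrunc min_l//; apply: ltW; apply: lt_le_trans (truncnS_gt _) _.
  by rewrite ler_nat.
have := @cvg_monotone_convergence _ _ _ (@row_measure R d) setT measurableT
  (fun n x => Vtrunc n x * (h x)%:E).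
move=> /(_ (fun n => emeasurable_funM (measurable_Vtrunc n) mhE)).
have p0 n x : setT x -> 0 <= Vtrunc n x * (h x)%:E.
  by move=> _; rewrite mule_ge0 ?Vtrunc_ge0 ?lee_fin.
have nd x : setT x -> nondecreasing_seq (fun n => Vtrunc n x * (h x)%:E).
  move=> _ m n mn; rewrite lee_wpmul2r ?lee_fin// /Vtrunc.
  by rewrite le_min !ge_min lexx/= ler_nat mn orbT.
move=> /(_ p0 nd) => c.
have -> : pairing (EFin \o Vk k) h =
    \int[@row_measure R d]_x limn (fun n => Vtrunc n x * (h x)%:E).
  by apply: eq_integral => x _; apply/esym/cvg_lim => //; exact: cv.
rewrite -(cvg_lim _ c)//; apply: lime_le; first by apply/cvg_ex; eexists; exact: c.
by apply: nearW => n; exact: hb.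
Qed.

End TruncatedWeight.

Lemma integral_between (R : realType) (c t : R) (h : R -> \bar R) : 0 <= t -> 0 <= c ->
  measurable_fun setT h -> (forall tau, 0 <= h tau)%E ->
  (forall tau, 0 <= tau <= t -> (h tau <= c%:E)%E) ->
  (\int[lebesgue_measure]_tau (between 0 tau t * h tau) < +oo)%E.
Proof.
move=> t0 c0 mh h0 hc.
apply: (@le_lt_trans _ _ (\int[lebesgue_measure]_(tau in `[0%R, t]) c%:E)%E).
  rewrite [leRHS]integral_mkcond; apply: ge0_le_integral => //.
  - by move=> tau _; rewrite mule_ge0 ?between_ge0.
  - by apply: emeasurable_funM => //; exact: measurable_between.
  - apply/(measurable_restrictT _ _).1 => //; exact: measurable_cst.
  move=> tau _; rewrite patchE; case: ifPn => [|].
    by rewrite inE/= in_itv/= => h1; rewrite /between h1 mul1e; exact: hc.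
  by rewrite notin_setE/= in_itv/= => /negP/negPf hn; rewrite /between hn mul0e.
rewrite integral_cst//= lebesgue_measure_itv/= lte_fin.
by case: ifP => _; rewrite ?mule0 ?ltry// -EFinB -EFinM ltry.
Qed.

(** * The weighted estimate for the mild solution *)

Theorem theorem3p4 (R : realType) (d : nat) (J : R -> 'rV[R]_d -> R)
    (s k eps C_L lam_L : R) :
  (0 < d)%N ->
  2^-1 < s < 1 -> 0 < k -> k < 2 * s -> k < 1 -> 0 < eps <= 1 ->
  H1 J ->
  0 < C_L -> 0 < lam_L ->
  (forall s' eps' : R, 2^-1 < s' < 1 -> 0 < eps' <= 1 ->
     forall x : 'rV[R]_d,
       (Lstar J s' eps' (Vk k) x <= (C_L - lam_L * Vk k x)%:E)%E) ->
  forall (u0 : 'rV[R]_d -> R) (u : R -> 'rV[R]_d -> R),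
    L1k k u0 ->
    mild_solution J s eps u0 u ->
    forall t : R, 0 <= t ->
      (normV k (u t) <=
         (expR (- lam_L * t))%:E * normV k u0
         + (C_L / lam_L * (1 - expR (- lam_L * t)))%:E * L1norm u0)%E.
Proof.
move=> _ hs _ _ _ heps [HJ _] C0 lam0 HL u0 u [mu0 _] [mu_ [_ [ubd ueq]]] t t0.
have [mJ [J0 [J1 _]]] := HJ s hs.
have {}mJ := meas_Rd_measurable_fun mJ.
have {}mu0 := meas_Rd_measurable_fun mu0.
have {}mu_ := meas_tRd_measurable_fun mu_.
have /andP[eps0 _] := heps.
have mg := measurable_Jeps eps mJ.
have g0 := Jeps_ge0 J0 eps0.
have g1 := Kop_cst1 mg g0 (integral_Jeps mJ J0 J1 eps0).
set g := Jeps J s eps in mg g0 g1.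
pose kap := eps `^ (- (2 * s)).
have kap0 : 0 <= kap by exact: powR_ge0.
have mus tau : measurable_fun setT (u tau).
  by apply: (@measurable_fun2 _ _ _ _ _ _ _ _ u).
pose f tau (x : 'rV[R]_d) := `|u tau x|.
pose f_ini (x : 'rV[R]_d) := `|u0 x|.
have mf : measurable_fun [set: R * 'rV[R]_d] (fun p => f p.1 p.2) by exact: measurableT_comp.
have f0 tau x : 0 <= f tau x by exact: normr_ge0.
have mfs tau : measurable_fun setT (f tau) by exact: measurableT_comp.
have mf_ini : measurable_fun setT f_ini by exact: measurableT_comp.
have f_ini0 x : 0 <= f_ini x by exact: normr_ge0.
have duhamel (tau : R) (psi : 'rV[R]_d -> \bar R) : 0 <= tau ->
    measurable_fun setT psi -> (forall x, 0 <= psi x)%E ->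
    (pairing psi (f tau) <= pairing (Qop kap tau psi) f_ini +
    kap%:E * \int[lebesgue_measure]_sig (between 0 sig tau *
       pairing (Kop g (Qop kap (tau - sig) psi)) (f sig)))%E.
  move=> tau0; apply: mild_duhamel => //.
  exact/ae_Rd_ae/ueq.
have lyap y := Lstar_lyapunov mJ J0 J1 eps0 (measurable_Vk k) (Vk_ge0 k) (HL s eps hs heps y).
pose G := lyapunov_bound (@Vk R d k) C_L lam_L t.
have mG : measurable_fun [set: R * 'rV[R]_d] (fun p => G p.1 p.2).
  by apply: measurable_lyapunov_bound; exact: measurable_Vk.
have G0 sig x : (0 <= G sig x)%E.
  by apply: lyapunov_bound_ge0 => //; [exact: ltW|exact: Vk_ge0].
(* At time 0 the bound is a V + b, so its pairing with |u0| is already the required right-hand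
   side. *)
have GE : pairing (G 0) f_ini = ((expR (- lam_L * t))%:E * normV k u0
         + (C_L / lam_L * (1 - expR (- lam_L * t)))%:E * L1norm u0)%E.
  have r0 : 0 <= expR (- lam_L * t) by exact: expR_ge0.
  have c0 : 0 <= C_L / lam_L * (1 - expR (- lam_L * t)).
    rewrite mulr_ge0 ?divr_ge0 ?(ltW C0) ?(ltW lam0)// subr_ge0 -expR0 ler_expR.
    by rewrite mulNr oppr_le0 mulr_ge0// ltW.
  rewrite normVE// L1normE//.
  rewrite (_ : G 0%R = fun x => (expR (- lam_L * t))%:E * (EFin \o Vk k) x +
    (C_L / lam_L * (1 - expR (- lam_L * t)))%:E * cst 1 x)%E; last first.
    by apply/funext => x; rewrite /G lyapunov_boundE// subr0 /= mule1 -EFinM -EFinD.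
  have mV : measurable_fun setT (EFin \o @Vk R d k).
    by apply/measurable_EFinP; exact: measurable_Vk.
  have V0 x : (0 <= (EFin \o @Vk R d k) x)%E by rewrite lee_fin Vk_ge0.
  rewrite pairingD//; last 3 first.
  - exact: measurable_funeM.
  - by move=> x; rewrite mule_ge0.
  - by move=> x; rewrite mule_ge0.
  rewrite pairingZ// pairingZ//; congr (_ + _ * _)%E.
  by apply: eq_integral => x _; rewrite mul1e.
rewrite -GE normVE//; apply: pairing_Vk_le => [||n]; [exact: mfs|exact: f0|].
have sG : supersolution g kap t (Vtrunc k n) G.
  apply: (@lyapunov_supersolution _ _ g kap mg g0 kap0 g1 (Vk k) (fun x => 'D_x (Vk k) x)).
  - exact: ltW.
  - exact: lam0.
  - exact: measurable_Vk.
  - exact: Vk_ge0.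
  - exact: lyap.
  - exact: is_derive_Vk_flow.
  - exact: continuous_derive_Vk_flow.
  - exact: measurable_Vtrunc.
  - exact: Vtrunc_ge0.
  - by move=> x; rewrite lee_fin ge_min lexx.
(* A finite remainder for [G] would presuppose moments of the solution, whereas the constant n
   involves only its L^1 norm. *)
pose G2 (sig : R) (x : 'rV[R]_d) : \bar R := n%:R%:E.
have mc : measurable_fun [set: 'rV[R]_d] (fun=> n%:R%:E : \bar R) by exact: measurable_cst.
have KG2 y : Kop g (fun=> n%:R%:E) y = n%:R%:E.
  have -> : (fun _ : 'rV[R]_d => n%:R%:E : \bar R) =
      (fun x : 'rV[R]_d => (n%:R%:E * cst 1 x)%E : \bar R).
    by apply: funext => x; rewrite /= mule1.
  rewrite KopZ ?lee_fin//.
  by rewrite [X in (_ * X)%E]g1 mule1.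
(* With Phi = n, C = n and lam = 1 the bound is n e^(-r) + n (1 - e^(-r)) = n, so the constant is
   covered by the same supersolution lemma. *)
have G2E : G2 = lyapunov_bound (fun=> n%:R) n%:R 1 t.
  by apply/funext => sig; apply/funext => x; rewrite /G2 /lyapunov_bound; congr EFin; field.
have sG2 : supersolution g kap t (Vtrunc k n) G2.
  rewrite G2E.
  apply: (@lyapunov_supersolution _ _ g kap mg g0 kap0 g1 (fun=> n%:R) (fun=> 0)).
  - exact: ler0n.
  - exact: ltr01.
  - exact: measurable_cst.
  - by move=> x; exact: ler0n.
  - by move=> y; rewrite [Kop _ _ _]KG2 -EFinM lee_fin; lra.
  - by move=> x sig tau; rewrite oppr0; exact: is_derive_cst.
  - by move=> x sig; exact: cst_continuous.
  - exact: measurable_Vtrunc.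
  - exact: Vtrunc_ge0.
  - by move=> x; rewrite lee_fin ge_min lexx orbT.
(* Here the local L^1 bound of the mild solution enters: K fixes constants, so the integrand is at
   most n M on [0, t]. *)
have rG2 : (remainder g kap f t G2 < +oo)%E.
  have [M hM] := ubd t t0.
  have M0 : 0 <= M.
    rewrite -lee_fin; apply: le_trans (hM 0 _); last by rewrite lexx.
    by rewrite L1normE//; apply: integral_ge0 => x _; rewrite lee_fin.
  rewrite /remainder lte_mul_pinfty ?lee_fin//.
  have -> : (fun tau => between 0 tau t * pairing (Kop g (G2 tau)) (f tau))%E =
      (fun tau => between 0 tau t * pairing (fun=> n%:R%:E) (f tau))%E.
    apply/funext => tau; congr (_ * pairing _ _)%E.
    by apply/funext => y; rewrite /G2 KG2.
  apply: (@integral_between _ (n%:R * M)) => //.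
  - by rewrite mulr_ge0.
  - apply: (@measurable_pairing _ _ _ _ (fun=> (fun=> n%:R%:E)) f) => //.
  - by move=> tau; apply: pairing_ge0.
  move=> tau ht; have := hM tau ht; rewrite L1normE// => h.
  rewrite EFinM /pairing ge0_integralZl; [|exact: measurableT|by apply/measurable_EFinP; exact: mfs
    |by move=> x _; rewrite lee_fin|by rewrite lee_fin].
  by apply: lee_wpmul2l => //; rewrite lee_fin.
apply: (@pairing_le_supersolution _ _ g kap mg g0 kap0 f f_ini mf f0 mf_ini f_ini0 duhamel
  t t0 (Vtrunc k n) (measurable_Vtrunc k n) (Vtrunc_ge0 k n) G G2 mG G0 _ _ sG sG2 rG2).
- by [].
- by move=> sig x; rewrite lee_fin.
Qed.
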